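(* Let $n$ be a positive integer such that $d=n^2+1$ is square-free and $d\equiv 1\pmod 8$. If $h(d)=3$, then $$\sum_{\substack{ |t|<\sqrt{d}\\ t^2\equiv d \pmod 4}}\sigma\left(\frac{d-t^2}{4}\right)=\frac{n^3+44n}{4}.$$ Conversely, if $h(d)$ is odd, $d\neq 17$, and $$\sum_{\substack{ |t|<\sqrt{d}\\ t^2\equiv d \pmod 4}}\sigma\left(\frac{d-t^2}{4}\right)=\frac{n^3+44n}{4},$$ then $h(d)=3$.
   Context: $h(d)$ denotes the class number of the real quadratic field $\mathbb{Q}(\sqrt{d})$. For a positive integer $m$, $\sigma(m)$ denotes the sum of the positive divisors of $m$. The sum runs over all integers $t$ (positive, negative or zero) satisfying the stated conditions. *)

(* Defs.v *)
From HB Require Import structures.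
From mathcomp Require Import all_boot all_order all_algebra all_field.
From mathcomp Require Import finmap.
From mathcomp Require Import boolp classical_sets functions cardinality fsbigop.

Set Implicit Arguments.
Unset Strict Implicit.
Unset Printing Implicit Defensive.

Import Order.TTheory GRing.Theory Num.Theory.
Local Open Scope classical_set_scope.
Local Open Scope ring_scope.

Definition squarefree (m : nat) : Prop := forall k : nat, (k ^ 2 %| m)%N -> k = 1%N.

Definition sigma (m : nat) : nat := (\sum_(e <- divisors m) e)%N.

Section ClassNumber.
Variable K : fieldType.

Definition ring_of_integers : set K := [set x | integralOver (intr : int -> K) x].

Definition fractional_ideal (I : set K) : Prop :=
  [/\ I 0,
      forall x y, I x -> I y -> I (x + y),
      forall a x, ring_of_integers a -> I x -> I (a * x),
      exists2 x, I x & x != 0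
    & exists c, [/\ ring_of_integers c, c != 0 &
        forall x, I x -> ring_of_integers (c * x)]].

Definition ideal_equiv (I J : set K) : Prop :=
  exists2 x : K, x != 0 & J = [set x * y | y in I].

Definition ideal_class (I : set K) : set (set K) :=
  [set J | fractional_ideal J /\ ideal_equiv I J].

Definition ideal_classes : set (set (set K)) :=
  [set ideal_class I | I in [set I | fractional_ideal I]].

(* [fset_set] of an infinite set is empty; for K a number field the set of
   ideal classes is finite. *)
Definition class_number : nat := #|` fset_set ideal_classes|.

End ClassNumber.

(* The field Q(sqrt d), generated over Q by the root [sqrtC d] of X^2 - d. *)
Definition quadratic_field (d : nat) : fieldType :=
  subFExtend (ratr : {rmorphism rat -> algC}) (sqrtC d%:R) ('X^2 - d%:R%:P).

Definition h (d : nat) : nat := class_number (quadratic_field d).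

(* The index set is finite, so this is a genuine finite sum; on it d - t^2 is
   positive and divisible by 4, so the integer quotient and the absolute value
   are exact. *)
Definition sigma_sum (d : nat) : nat :=
  \sum_(t \in [set t : int | `|t%:~R| < sqrtC d%:R :> algC
                             /\ (t ^+ 2 = d%:Z %[mod 4])%Z])
     sigma `|((d%:Z - t ^+ 2) %/ 4)%Z|%N.

(* Main.v *)
(** Here [n = 4 m] and [d = 16 m^2 + 1].  The sum of [sigma ((d - t^2) / 4)] is
    the sum of [a] over the simple forms [a X^2 + b XY - c Y^2], with [a, c > 0]
    and [b^2 + 4 a c = d].  A form gives the lattice [Z a + Z (b + sqrt d) / 2];
    every ideal class contains such a lattice, and, because [n + sqrt d] has norm
    -1, two simple forms in one class are linked by the steps of the additive
    continued fraction algorithm.  The cycles of the trivial class and of the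
    classes of the two primes above 2 are computed explicitly; the values of [a]
    along them add up to [16 m^3 + 44 m], and for [m >= 3] the three classes are
    distinct.  So both [h d = 3] and the identity say that these cycles exhaust
    the simple forms.  For [m <= 2] there are at most two classes, and for
    [m = 2] the sum is 160 instead of 216. *)

Require Import Defs.
From mathcomp Require Import all_boot all_order all_algebra all_field.
From mathcomp Require Import finmap.
From mathcomp Require Import boolp classical_sets functions cardinality fsbigop.
From mathcomp Require Import zify ring.
Set Implicit Arguments.
Unset Strict Implicit.
Unset Printing Implicit Defensive.
Import Order.TTheory GRing.Theory Num.Theory.
Local Open Scope classical_set_scope.
Local Open Scope ring_scope.

(** * Cycles of simple forms *)

(** The cycles are never run through as sequences; neither length nor periodicity is used. A cycle
    is a predicate on forms: if it and its conjugate are [step_closed] and it contains one form of a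
    class, it contains all simple forms of that class. Conversely, invariance of the class under
    translating and exchanging basis vectors puts every form of the predicate into it. The obstacle
    to the first half is that an ideal equivalence yields an arbitrary integer matrix of determinant
    1 or -1. Determinant -1 is removed by the unit of norm -1; then the signs of the values [a] and
    [- c] leave only matrices that the Euclidean algorithm factors into steps in one direction.
    There are two primes above 2 because [d] is 1 modulo 8; their lattices have [(a, b) = (2, 1)]
    and [(2, -1)]. On the arithmetic side, the forms with a given [b] correspond to the divisors of
    [(d - b^2) / 4], so for [m >= 3] the sum exceeds the target by a sum of positive integers over
    the unlisted forms. *)

Definition qform (a b c x y : int) : int := a * x ^+ 2 + b * (x * y) - c * y ^+ 2.

(** The polar form: the value of [qform] at [(x + z, y + u)] minus its values at [(x, y)] and
    [(z, u)]. It is the middle coefficient of the form in the basis [(x, y), (z, u)]. *)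
Definition qpolar (a b c x y z u : int) : int :=
  2 * a * (x * z) + b * (x * u + y * z) - 2 * c * (y * u).

Definition simple_form (d a b c : int) : Prop :=
  [/\ 0 < a, 0 < c & b ^+ 2 + 4 * (a * c) = d].

(* The new form is [a X^2 + b XY - c Y^2] in the basis [(e1, e1 + e2)] or
   [(e1 + e2, e2)], whichever keeps it simple. *)
Definition step_closed (d : int) (L : int -> int -> int -> Prop) : Prop :=
  forall a b c, simple_form d a b c -> L a b c ->
    (a + b < c -> L a (b + 2 * a) (c - a - b)) /\
    (c < a + b -> L (a + b - c) (b - 2 * c) c).

(* [a + b t - c t^2] changes sign only once on [t >= 0], so a vector with a
   positive value has smaller slope than one with a negative value. *)
Lemma qform_slope (a b c x y z u : int) : 0 < a -> 0 < c ->
  0 <= x -> 0 <= y -> 0 <= z -> 0 <= u ->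
  0 < qform a b c x y -> qform a b c z u < 0 -> y * z < x * u.
Proof.
move=> a0 c0 x0 y0 z0 u0 Qp Qn; rewrite ltNge; apply/negP => le.
have x1 : 0 < x.
  rewrite lt_neqAle x0 andbT; apply/eqP => e; subst x.
  by move: Qp; rewrite /qform; nia.
have key : x * y * qform a b c z u =
    (y * z - x * u) * (a * (x * z)) + u * z * qform a b c x y
    + c * (u * y) * (y * z - x * u) by rewrite /qform; ring.
have le0 : 0 <= y * z - x * u by rewrite subr_ge0.
have rhs : 0 <= x * y * qform a b c z u.
  by rewrite key !addr_ge0 ?mulr_ge0 // ltW.
have y1 : 0 < y.
  rewrite lt_neqAle y0 andbT; apply/eqP => e; subst y.
  have u00 : u = 0 by nia.
  by move: Qn; rewrite u00 /qform; nia.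
by move: rhs; rewrite leNgt pmulr_rlt0 ?mulr_gt0 // Qn.
Qed.

(** [a + b - c] is the value at [(1, 1)]; a zero there makes the discriminant a square. So exactly
    one of the two steps applies. *)
Lemma simple_form_diag (d a b c : int) : (forall k : int, k ^+ 2 != d) ->
  simple_form d a b c -> a + b != c.
Proof.
move=> nsq [_ _ e]; apply: contraNneq (nsq (b + 2 * a)) => ec.
by apply/eqP; rewrite -e -ec; ring.
Qed.

(** The Euclidean algorithm on the rows [(x, y)] and [(z, u)], by induction on the sum of the
    entries. The sign at [(1, 1)] selects the step, and comparing slopes with [(1, 1)] settles the
    order within one row. Either the other row has the same order and one column is subtracted from
    the other, or determinant 1 forces the identity. *)
Lemma step_closed_nneg (d : int) L : (forall k : int, k ^+ 2 != d) ->
  step_closed d L -> forall x y z u a b c : int,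
  0 <= x -> 0 <= y -> 0 <= z -> 0 <= u -> x * u - y * z = 1 ->
  simple_form d a b c -> L a b c ->
  0 < qform a b c x y -> qform a b c z u < 0 ->
  L (qform a b c x y) (qpolar a b c x y z u) (- qform a b c z u).
Proof.
move=> nsq Lc x y z u; have [k] := ubnP (absz (x + y + z + u)).
elim: k x y z u => // k IH x y z u lek a b c x0 y0 z0 u0 det sf Lf Qp Qn.
have [a0 c0 disc] := sf.
have [lt|gt|/eqP e] := ltrgtP (a + b) c; last first.
- by have := simple_form_diag nsq sf; rewrite e.
- have Q11 : 0 < qform a b c 1 1 by rewrite /qform; lia.
  have zu := qform_slope a0 c0 ler01 ler01 z0 u0 Q11 Qn.
  rewrite !mul1r in zu.
  have [xy|xy] := lerP x y; last first.
    have [ex ey ez eu] : [/\ x = 1, y = 0, z = 0 & u = 1] by split; nia.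
    rewrite ex ey ez eu in Qp Qn *.
    have -> : qform a b c 1 0 = a by rewrite /qform; ring.
    have -> : qform a b c 0 1 = - c by rewrite /qform; ring.
    have -> : qpolar a b c 1 0 0 1 = b by rewrite /qpolar; ring.
    by rewrite opprK.
  have xz : 0 < x + z by nia.
  have e1 X Y : qform (a + b - c) (b - 2 * c) c X (Y - X) = qform a b c X Y.
    by rewrite /qform; ring.
  have e2 : qpolar (a + b - c) (b - 2 * c) c x (y - x) z (u - z)
    = qpolar a b c x y z u by rewrite /qpolar; ring.
  rewrite -e2 -(e1 x y) -(e1 z u); apply: IH; rewrite ?e1 //; try lia.
  + by split; [lia | | rewrite -disc; ring].
  + by case: (Lc _ _ _ sf Lf) => _; apply.
- have Q11 : qform a b c 1 1 < 0 by rewrite /qform; lia.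
  have xy := qform_slope a0 c0 x0 y0 ler01 ler01 Qp Q11.
  rewrite !mulr1 in xy.
  have [zu|zu] := lerP u z; last first.
    have [ex ey ez eu] : [/\ x = 1, y = 0, z = 0 & u = 1] by split; nia.
    rewrite ex ey ez eu in Qp Qn *.
    have -> : qform a b c 1 0 = a by rewrite /qform; ring.
    have -> : qform a b c 0 1 = - c by rewrite /qform; ring.
    have -> : qpolar a b c 1 0 0 1 = b by rewrite /qpolar; ring.
    by rewrite opprK.
  have yu : 0 < y + u by nia.
  have e1 X Y : qform a (b + 2 * a) (c - a - b) (X - Y) Y = qform a b c X Y.
    by rewrite /qform; ring.
  have e2 : qpolar a (b + 2 * a) (c - a - b) (x - y) y (z - u) u
    = qpolar a b c x y z u by rewrite /qpolar; ring.
  rewrite -e2 -(e1 x y) -(e1 z u); apply: IH; rewrite ?e1 //; try lia.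
  + by split; [ | lia | rewrite -disc; ring].
  + by case: (Lc _ _ _ sf Lf) => + _; apply.
Qed.

(* The signs of the values force the matrix or its inverse to be nonnegative, up
   to sign; conjugating by [diag (1, -1)] turns the second case into the first. *)
Lemma step_closed_SL2 (d : int) (L : int -> int -> int -> Prop) :
  (forall k : int, k ^+ 2 != d) -> step_closed d L ->
  step_closed d (fun a b c => L a (- b) c) -> forall x y z u a b c : int,
  x * u - y * z = 1 -> simple_form d a b c -> L a b c ->
  0 < qform a b c x y -> qform a b c z u < 0 ->
  L (qform a b c x y) (qpolar a b c x y z u) (- qform a b c z u).
Proof.
move=> nsq Lc Lc'.
suff pos x y z u a b c : 0 < x -> x * u - y * z = 1 -> simple_form d a b c ->
    L a b c -> 0 < qform a b c x y -> qform a b c z u < 0 ->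
    L (qform a b c x y) (qpolar a b c x y z u) (- qform a b c z u).
  move=> x y z u a b c det sf Lf Qp Qn; have [xn|xp|x0] := ltrgtP x 0.
  - have e1 X Y : qform a b c (- X) (- Y) = qform a b c X Y by rewrite /qform; ring.
    have e2 : qpolar a b c (- x) (- y) (- z) (- u) = qpolar a b c x y z u.
      by rewrite /qpolar; ring.
    rewrite -e2 -(e1 x y) -(e1 z u); apply: pos; rewrite ?e1 ?oppr_gt0 //.
    by rewrite !mulrNN.
  - exact: pos.
  - by move: Qp sf; rewrite x0 /qform => + [_ ? _]; nia.
move=> x0 det sf Lf Qp Qn; have [a0 c0 disc] := sf.
have nsim X Y : qform a (- b) c X (- Y) = qform a b c X Y by rewrite /qform; ring.
have [un|up|u0] := ltrgtP u 0.
(* Impossible case: [y] and [z] have opposite signs. Negating the second vector, or both second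
   coordinates, gives nonnegative vectors whose slope order contradicts determinant 1. *)
- have yz : y * z < 0 by nia.
  have [y0|y0] := lerP 0 y.
    have zn : z < 0 by nia.
    have Qn' : qform a b c (- z) (- u) < 0.
      by rewrite (_ : qform _ _ _ _ _ = qform a b c z u) // /qform; ring.
    have := qform_slope a0 c0 (ltW x0) y0 _ _ Qp Qn'; nia.
  have zp : 0 < z by nia.
  have Qp' : 0 < qform a (- b) c x (- y) by rewrite nsim.
  have Qn' : qform a (- b) c z (- u) < 0 by rewrite nsim.
  have := qform_slope a0 c0 (ltW x0) _ (ltW zp) _ Qp' Qn'; nia.
(* Here [y z = x u - 1 >= 0], so [y] and [z] do not have opposite signs. *)
- have [/andP[y0 z0]|nn] := boolP ((0 <= y) && (0 <= z)).
    by apply: (step_closed_nneg nsq Lc) => //; exact: ltW.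
  have [yn zn] : y <= 0 /\ z <= 0.
    by move: nn; rewrite negb_and -!ltNge => /orP[] ?; split; nia.
  have nsim2 : qform a (- b) c (- z) u = qform a b c z u by rewrite /qform; ring.
  have e3 : qpolar a (- b) c x (- y) (- z) u = - qpolar a b c x y z u.
    by rewrite /qpolar; ring.
  rewrite -[qpolar _ _ _ _ _ _ _]opprK -e3 -nsim -nsim2.
  apply: (step_closed_nneg nsq Lc'); rewrite ?nsim ?nsim2 ?opprK //; try lia.
  by split=> //; rewrite -disc; ring.
- by move: Qn; rewrite u0 /qform; nia.
Qed.

(** The two linear relations are what an ideal equivalence leaves once its multiplier is eliminated.
    They make [(a, b, c)] equal to [D] times the transform of [(a', b', c')], where [D] is the
    determinant; for [D = -1], composing with the unit restores determinant 1. *)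
Lemma step_closed_equiv (n d : int) (L : int -> int -> int -> Prop) :
  d = n ^+ 2 + 1 -> (forall k : int, k ^+ 2 != d) -> step_closed d L ->
  step_closed d (fun a b c => L a (- b) c) ->
  forall a b c a' b' c' x y z u : int,
  simple_form d a b c -> simple_form d a' b' c' ->
  x * u - y * z = 1 \/ x * u - y * z = -1 ->
  2 * a * u = 2 * x * a' + y * (b' + b) ->
  2 * a * z = x * (b - b') + 2 * y * c' ->
  L a' b' c' -> L a b c.
Proof.
move=> dE nsq Lc Lc' a b c a' b' c' x y z u [a0 c0 disc] sf' det E1 E2 Lf.
have [a0' c0' disc'] := sf'.
set D := x * u - y * z in det.
have D2 : D ^+ 2 = 1 by case: det => ->.
have ea : D * a = qform a' b' c' x y.
  have : 2 * (D * a) = 2 * qform a' b' c' x y.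
    transitivity (x * (2 * a * u) - y * (2 * a * z)); first by rewrite /D; ring.
    by rewrite E1 E2 /qform; ring.
  by apply: mulfI.
have eb : D * b = qpolar a' b' c' x y z u.
  have /eqP : z * (2 * a * u) = u * (2 * a * z) by ring.
  rewrite E1 E2 -subr_eq0 => /eqP e; apply/eqP; rewrite -subr_eq0; apply/eqP.
  by rewrite -[RHS]oppr0 -[in RHS]e /D /qpolar; ring.
(* The relations do not contain [c]; it is recovered by comparing discriminants. *)
have ec : D * c = - qform a' b' c' z u.
  have : 4 * (D * a) * (D * c) = 4 * (D * a) * (- qform a' b' c' z u).
    transitivity (D ^+ 2 * (d - b ^+ 2)); first by rewrite -disc; ring.
    transitivity (D ^+ 2 * d - (D * b) ^+ 2); first by ring.
    by rewrite ea eb -disc' /D /qform /qpolar; ring.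
  apply: mulfI; rewrite !mulf_neq0 ?(gt_eqF a0) //.
  by case: det => ->.
have [D1|D1] := det.
  rewrite D1 !mul1r in ea eb ec; rewrite ea eb ec.
  apply: (step_closed_SL2 nsq Lc Lc') => //; rewrite -?ea //.
  by rewrite -oppr_gt0 -ec.
rewrite D1 !mulN1r in ea eb ec.
(* The unit [n + sqrt d] has norm -1 and acts on the basis of [(a, b, c)] by
   the matrix with rows [(n - b, 2 a)] and [(2 c, n + b)]. *)
pose x1 := (n - b) * x + 2 * a * z; pose y1 := (n - b) * y + 2 * a * u.
pose z1 := 2 * c * x + (n + b) * z; pose u1 := 2 * c * y + (n + b) * u.
have n2 : n ^+ 2 = b ^+ 2 + 4 * (a * c) - 1 by rewrite disc dE; ring.
have det1 : x1 * u1 - y1 * z1 = 1.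
  transitivity (D * (n ^+ 2 - (b ^+ 2 + 4 * (a * c)))).
    by rewrite /D /x1 /y1 /z1 /u1; ring.
  by rewrite n2 D1; ring.
have fa : qform a' b' c' x1 y1 = a.
  transitivity ((n - b) ^+ 2 * qform a' b' c' x y
    + (n - b) * 2 * a * qpolar a' b' c' x y z u
    + (2 * a) ^+ 2 * qform a' b' c' z u).
    by rewrite /x1 /y1 /qform /qpolar; ring.
  rewrite -ea -eb (_ : qform a' b' c' z u = c); last by rewrite -[LHS]opprK -ec opprK.
  transitivity (a * (b ^+ 2 + 4 * (a * c) - n ^+ 2)); first by ring.
  by rewrite n2; ring.
have fc : qform a' b' c' z1 u1 = - c.
  transitivity ((2 * c) ^+ 2 * qform a' b' c' x y
    + (2 * c) * (n + b) * qpolar a' b' c' x y z u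
    + (n + b) ^+ 2 * qform a' b' c' z u).
    by rewrite /z1 /u1 /qform /qpolar; ring.
  rewrite -ea -eb (_ : qform a' b' c' z u = c); last by rewrite -[LHS]opprK -ec opprK.
  transitivity (c * (n ^+ 2 - (b ^+ 2 + 4 * (a * c)))); first by ring.
  by rewrite n2; ring.
have fb : qpolar a' b' c' x1 y1 z1 u1 = b.
  transitivity (2 * ((n - b) * (2 * c)) * qform a' b' c' x y
    + ((n - b) * (n + b) + 2 * a * (2 * c)) * qpolar a' b' c' x y z u
    + 2 * (2 * a * (n + b)) * qform a' b' c' z u).
    by rewrite /x1 /y1 /z1 /u1 /qform /qpolar; ring.
  rewrite -ea -eb (_ : qform a' b' c' z u = c); last by rewrite -[LHS]opprK -ec opprK.
  transitivity (b * (b ^+ 2 + 4 * (a * c) - n ^+ 2)); first by ring.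
  by rewrite n2; ring.
have := @step_closed_SL2 d L nsq Lc Lc' x1 y1 z1 u1 a' b' c' det1 sf' Lf.
by rewrite fa fb fc opprK oppr_lt0; apply.
Qed.

(* The simple forms in the trivial class, and those in the class of
   [(2, (1 + sqrt d) / 2)]; the conjugate class is obtained by [b |-> - b]. *)
Definition unit_list (m a b c : int) : Prop := [\/ a = 1, c = 1 | a = 2 * m /\ c = 2 * m].

Definition two_list (m a b c : int) : Prop :=
  [\/ a = 2 /\ (exists k, b = 4 * k + 1), c = 2 /\ (exists k, b = 4 * k + 3),
      [\/ [/\ a = 3 * m + 1, b = 1 - 2 * m & c = m],
          [/\ a = 4 * m, b = 1 & c = m]
        | [/\ a = 3 * m - 1, b = 2 * m + 1 & c = m]]
    | [\/ [/\ a = m, b = 2 * m - 1 & c = 3 * m + 1],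
          [/\ a = m, b = -1 & c = 4 * m]
        | [/\ a = m, b = - 2 * m - 1 & c = 3 * m - 1]]].

Lemma form_odd (m a b c : int) : 0 < m -> simple_form (16 * m ^+ 2 + 1) a b c ->
  (exists k, b = 2 * k + 1) /\ `|b| <= 4 * m - 1.
Proof.
move=> m0 [a0 c0 disc]; split.
  exists ((b - 1) %/ 2)%Z; nia.
nia.
Qed.

(** The cycle: forms with [a = 1], [b] rising to [4 m - 1]; then [(2 m, -1, 2 m)]; forms with
    [c = 1], [b] falling to [1 - 4 m]; then [(2 m, 1, 2 m)] and back. As [unit_list] ignores [b], it
    is its own conjugate. *)
Lemma unit_list_closed (m : int) : 0 < m ->
  step_closed (16 * m ^+ 2 + 1) (unit_list m).
Proof.
move=> m0 a b c sf; have [[k ek] bm] := form_odd m0 sf; have [a0 c0 disc] := sf.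
case=> [a1|c1|[a1 c1]]; split => lt.
- by constructor 1.
- have bE : b = 4 * m - 1 by nia.
  by constructor 3; nia.
- have bE : b = 1 - 4 * m by nia.
  by constructor 3; nia.
- by constructor 2.
- by constructor 2; nia.
- by constructor 1; nia.
Qed.

(** The cycle: forms with [a = 2], up to [b = 4 m - 3]; three with [a = m] and
    [b = - 2 m - 1, -1, 2 m - 1]; forms with [c = 2], down to [b = 3 - 4 m]; three with [c = m] and
    [b = 2 m + 1, 1, 1 - 2 m]; back to [a = 2]. *)
Lemma two_list_closed (m : int) : 0 < m ->
  step_closed (16 * m ^+ 2 + 1) (two_list m).
Proof.
move=> m0 a b c sf; have [[k ek] bm] := form_odd m0 sf; have [a0 c0 disc] := sf.
case=> [[a1 [j ej]]|[c1 [j ej]]|[] [a1 b1 c1]|[] [a1 b1 c1]]; split => lt.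
- by constructor 1; split=> //; exists (j + 1); rewrite a1 ej; ring.
- have jE : j = m - 1 by nia.
  by constructor 4; constructor 3; split; nia.
- have jE : j = - m by nia.
  by constructor 3; constructor 3; split; nia.
- by constructor 2; split=> //; exists (j - 1); rewrite c1 ej; ring.
- lia.
- by constructor 1; split; [lia | exists (- m); lia].
- lia.
- by constructor 3; constructor 1; split; lia.
- lia.
- by constructor 3; constructor 2; split; lia.
- by constructor 2; split; [lia | exists (m - 1); lia].
- lia.
- by constructor 4; constructor 1; split; lia.
- lia.
- by constructor 4; constructor 2; split; lia.
- lia.
Qed.

(** Changing the sign of [b] reverses a step, so this is closure of [two_list] under inverse steps:
    the same cycle run backwards. *)
Lemma two_list_conj_closed (m : int) : 0 < m ->
  step_closed (16 * m ^+ 2 + 1) (fun a b c => two_list m a (- b) c).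
Proof.
move=> m0 a b c sf; have [[k ek] bm] := form_odd m0 sf; have [a0 c0 disc] := sf.
case=> [[a1 [j ej]]|[c1 [j ej]]|[] [a1 b1 c1]|[] [a1 b1 c1]]; split => lt.
- by constructor 1; split=> //; exists (j - 1); rewrite a1; lia.
- have jE : j = - m by nia.
  by constructor 3; constructor 1; split; nia.
- have jE : j = m - 1 by nia.
  by constructor 4; constructor 1; split; nia.
- by constructor 2; split=> //; exists (j + 1); rewrite c1; lia.
- lia.
- by constructor 3; constructor 2; split; lia.
- lia.
- by constructor 3; constructor 3; split; lia.
- by constructor 2; split; [lia | exists (- m); lia].
- lia.
- by constructor 4; constructor 2; split; lia.
- lia.
- by constructor 4; constructor 3; split; lia.
- lia.
- lia.
- by constructor 1; split; [lia | exists (m - 1); lia].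
Qed.

(** * Ideals of the quadratic field *)

Lemma int_subgroup_gen (P : int -> Prop) (x0 : int) : x0 != 0 -> P x0 ->
  (forall x y, P x -> P y -> P (x - y)) ->
  exists g : int, [/\ 0 < g, P g & forall x, P x -> exists v, x = g * v].
Proof.
move=> x0_neq0 Px0 PB.
have P0 : P 0 by rewrite -(subrr x0); apply: PB.
have PN x : P x -> P (- x) by move=> Px; rewrite -sub0r; apply: PB.
have PM x (k : nat) : P x -> P (x *+ k).
  by move=> Px; elim: k => // k IH; rewrite mulrSr -[x in _ + x]opprK; apply: PB => //; apply: PN.
have PZ x (k : int) : P x -> P (k * x).
  move=> Px; case: (intP k) => [|k'|k']; rewrite ?mul0r //.
    by have := PM x k'.+1 Px; rewrite -mulr_natl natz.
  by rewrite mulNr; apply: PN; have := PM x k'.+1 Px; rewrite -mulr_natl natz.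
have exP : exists k : nat, (0 < k)%N && `[< P k%:Z >].
  exists `|x0|%N; rewrite absz_gt0 x0_neq0; apply/asboolP; rewrite abszE.
  by case: (ger0P x0) => // _; apply: PN.
case: (ex_minnP exP) => g /andP[g0 /asboolP Pg] gmin.
exists g; split => // x Px; exists (x %/ g%:Z)%Z.
have r0 : (x %% g%:Z)%Z = 0; last by rewrite {1}(divz_eq x g) r0 addr0 mulrC.
have Pr : P (x %% g%:Z)%Z.
  by rewrite (_ : (x %% g)%Z = x - (x %/ g)%Z * g%:Z) //; apply: PB => //; apply: PZ.
have g1 : g%:Z != 0 by lia.
have rge := modz_ge0 x g1; have rlt : (x %% g)%Z < g by apply: ltz_pmod; lia.
apply/eqP/negP => /negP r_neq0.
have := gmin `|(x %% g)%Z|%N; rewrite absz_gt0 r_neq0 abszE ger0_norm // => /(_ _).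
have -> : `[< P (x %% g)%Z >] by apply/asboolP.
by move=> /(_ isT); lia.
Qed.

Lemma squarefree_dvd_sqr (d r t : int) :
  (forall k : int, (k ^+ 2 %| d)%Z -> `|k| = 1) -> r != 0 ->
  (r ^+ 2 %| d * t ^+ 2)%Z -> (r %| t)%Z.
Proof.
move=> sqf r0 dv.
have g0 : gcdz r t != 0 by rewrite gcdz_eq0 (negPf r0).
have [r' er] := dvdzP (dvdz_gcdl r t); have [t' et] := dvdzP (dvdz_gcdr r t).
have [u [v]] := Bezoutz r t.
move: (gcdz r t) er et g0 => g er et g0 eg.
have cop : coprimez r' t'.
  apply/coprimezP; exists (u, v) => /=; apply: (mulIf g0).
  by rewrite mul1r -[RHS]eg er et mulrDl !mulrA.
have : (r' ^+ 2 %| d * t' ^+ 2)%Z.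
  move: dv; rewrite er et !exprMn mulrA dvdz_mul2r ?expf_neq0 //.
rewrite Gauss_dvdzl ?coprimezXl ?coprimezXr // => /sqf r1.
rewrite er et dvdz_mul2r ?g0 //.
by rewrite dvdzE; have -> : `|r'|%N = 1%N by lia.
Qed.

Section IdealEquiv.
Variable K : fieldType.

Lemma ideal_equiv_refl (I : set K) : ideal_equiv I I.
Proof.
exists 1; first exact: oner_neq0.
by apply/seteqP; split=> [x Ix|_ [x Ix <-]]; [exists x; rewrite ?mul1r | rewrite mul1r].
Qed.

Lemma ideal_equiv_sym (I J : set K) : ideal_equiv I J -> ideal_equiv J I.
Proof.
move=> [x x0 ->]; exists x^-1; first by rewrite invr_neq0.
apply/seteqP; split=> [y Iy|_ [_ [y Iy <-] <-]]; last by rewrite mulKf.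
by exists (x * y); [exists y | rewrite mulKf].
Qed.

Lemma ideal_equiv_trans (I J L : set K) :
  ideal_equiv I J -> ideal_equiv J L -> ideal_equiv I L.
Proof.
move=> [x x0 ->] [y y0 ->]; exists (y * x); first by rewrite mulf_neq0.
apply/seteqP; split=> [_ [_ [z Iz <-] <-]|_ [z Iz <-]].
  by exists z; rewrite ?mulrA.
by exists (x * z); [exists z | rewrite mulrA].
Qed.

Lemma ideal_class_eq (I J : set K) : fractional_ideal J ->
  ideal_class I = ideal_class J <-> ideal_equiv I J.
Proof.
move=> fJ; split=> [E|IJ].
  have : ideal_class J J by split=> //; exact: ideal_equiv_refl.
  by rewrite -E => -[].
apply/seteqP; split=> L [fL ?]; split=> //.
  by apply: ideal_equiv_trans (ideal_equiv_sym IJ) _.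
by apply: ideal_equiv_trans IJ _.
Qed.
End IdealEquiv.

(** * The maximal order [Z + Z w], with [w = (1 + sqrt d) / 2] and [d = 4 e + 1], and its ideals *)

Section QuadraticField.
Variables (K : fieldType) (phi : {rmorphism K -> algC}) (w : K) (e : int).
Hypothesis w_sqr : w ^+ 2 = w + e%:~R.
Hypothesis w_gen : forall x : K, exists p q r : int,
  r != 0 /\ r%:~R * x = p%:~R + q%:~R * w.
Hypothesis nonsquare : forall k : int, k ^+ 2 != 4 * e + 1.
Hypothesis sqfree : forall k : int, (k ^+ 2 %| 4 * e + 1)%Z -> `|k| = 1.

Lemma intr_inj_quad : injective (intr : int -> K).
Proof. by move=> a b ab; have := congr1 phi ab; rewrite !rmorph_int => /intr_inj. Qed.

Lemma intr_neq0_quad (a : int) : a != 0 -> a%:~R != 0 :> K.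
Proof. by apply: contraNneq => a0; apply/eqP/intr_inj_quad. Qed.

(** Four times the norm of [p + q w] is [(2 p + q)^2 - (4 e + 1) q^2]; if it vanishes with [q != 0],
    then [4 e + 1] is a square. *)
Lemma quad_basis_free (p q : int) : p%:~R + q%:~R * w = 0 -> p = 0 /\ q = 0.
Proof.
move=> pq0.
suff q0 : q = 0.
  by move: pq0; rewrite q0 mul0r addr0 => p0; split=> //; apply: intr_inj_quad.
apply/eqP/negP => /negP q_neq0.
have sq : (2 * p + q) ^+ 2 = (4 * e + 1) * q ^+ 2.
  apply: intr_inj_quad; apply/eqP; rewrite -subr_eq0; apply/eqP.
  transitivity (4 * (p%:~R + q%:~R * w) * (p%:~R + q%:~R * (1 - w))
     + 4 * q%:~R ^+ 2 * (w ^+ 2 - (w + e%:~R))); first by ring.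
  by rewrite pq0 w_sqr; ring.
have /dvdzP[k ek] : (q %| 2 * p + q)%Z.
  have : (q ^+ 2 %| (2 * p + q) ^+ 2)%Z by rewrite sq dvdz_mull.
  by rewrite !dvdzE !abszX dvdn_pexp2r.
case/negP: (nonsquare k); apply/eqP.
have := expf_neq0 2 q_neq0 => /mulIf; apply.
by rewrite -sq ek exprMn.
Qed.

Lemma quad_basis_inj (p q p' q' : int) :
  p%:~R + q%:~R * w = p'%:~R + q'%:~R * w -> p = p' /\ q = q'.
Proof.
move=> /eqP; rewrite -subr_eq0 => /eqP E.
have [|/eqP + /eqP] := @quad_basis_free (p - p') (q - q').
  by rewrite -E; ring.
by rewrite !subr_eq0 => /eqP -> /eqP ->.
Qed.

(** Stands in for the automorphism [w |-> 1 - w]: an integer polynomial takes conjugate values at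
    [x] and [x'], so a root [x] gives a root [x']. *)
Lemma conj_horner (f : {poly int}) (p q r : int) (x x' : K) : r != 0 ->
  r%:~R * x = p%:~R + q%:~R * w -> r%:~R * x' = p%:~R + q%:~R * (1 - w) ->
  exists A B R : int, [/\ R != 0,
    R%:~R * (map_poly intr f).[x] = A%:~R + B%:~R * w
    & R%:~R * (map_poly intr f).[x'] = A%:~R + B%:~R * (1 - w)].
Proof.
move=> r0 ex ex'; elim/poly_ind: f => [|f c [A [B [R [R0 e1 e2]]]]].
  by exists 0, 0, 1; rewrite rmorph0 !horner0; split=> //; ring.
exists (A * p + B * q * e + R * r * c), (A * q + B * p + B * q), (R * r).
have step y : (map_poly intr (f * 'X + c%:P)).[y] = (map_poly intr f).[y] * y + c%:~R :> K.
  by rewrite rmorphD rmorphM /= map_polyX map_polyC hornerMXaddC.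
rewrite mulf_neq0 // !step; split=> //.
  transitivity ((R%:~R * (map_poly intr f).[x]) * (r%:~R * x)
    + (R * r * c)%:~R); first by ring.
  rewrite e1 ex; apply/eqP; rewrite -subr_eq0; apply/eqP.
  transitivity (B%:~R * q%:~R * (w ^+ 2 - (w + e%:~R))); first by ring.
  by rewrite w_sqr subrr mulr0.
transitivity ((R%:~R * (map_poly intr f).[x']) * (r%:~R * x')
    + (R * r * c)%:~R); first by ring.
rewrite e2 ex'; apply/eqP; rewrite -subr_eq0; apply/eqP.
transitivity (B%:~R * q%:~R * (w ^+ 2 - (w + e%:~R))); first by ring.
by rewrite w_sqr subrr mulr0.
Qed.

Lemma integral_ratio (T : K) (p r : int) : r != 0 ->
  integralOver (intr : int -> K) T -> r%:~R * T = p%:~R ->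
  exists P : int, p = r * P.
Proof.
move=> r0 [f f_mon f_root] E.
have TA : phi T \in Aint.
  have := f_root; rewrite -(fmorph_root phi) -map_poly_comp => rt.
  apply: (root_monic_Aint rt); first by rewrite monic_map.
  apply/polyOverP => i; rewrite coef_map /= rmorph_int; exact: intr_int.
have r0C : r%:~R != 0 :> algC by rewrite intr_eq0.
have TE : phi T = p%:~R / r%:~R.
  by apply: (mulfI r0C); rewrite mulrCA divff // mulr1 -!(rmorph_int phi) -rmorphM /= E.
have TQ : phi T \in Crat by rewrite TE rpred_div // rpred_int.
have /intrP[P EP] := Cint_rat_Aint TQ TA.
by exists P; apply: (@intr_inj algC); rewrite rmorphM /= -EP TE mulrCA divff // mulr1.
Qed.

(** The trace [P] and norm [N] of an integral [x] are integers with
    [P^2 - 4 N = (4 e + 1) (q / r)^2]. Square-freeness makes [Q = q / r] an integer, and [P^2 = Q^2]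
    modulo 4 gives equal parity, so [p / r = (P - Q) / 2] is an integer too. *)
Lemma ring_of_integersE (x : K) :
  ring_of_integers x <-> exists p q : int, x = p%:~R + q%:~R * w.
Proof.
split=> [xO|[p [q ->]]].
  have [p [q [r [r0 ex]]]] := w_gen x.
  have rK := intr_neq0_quad r0.
  pose x' := (p%:~R + q%:~R * (1 - w)) / r%:~R.
  have ex' : r%:~R * x' = p%:~R + q%:~R * (1 - w) by rewrite mulrCA divff ?mulr1.
  have x'O : ring_of_integers x'.
    have [f f_mon /rootP f_root] := xO.
    exists f => //; apply/rootP.
    have [A [B [R [R0 e1 e2]]]] := conj_horner f r0 ex ex'.
    move: e1; rewrite f_root mulr0 => /esym/quad_basis_free[A0 B0].
    move: e2; rewrite A0 B0 mul0r addr0 => /eqP; rewrite mulf_eq0 => /orP[|/eqP //].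
    by rewrite (negPf (intr_neq0_quad R0)).
  have [P eP] : exists P : int, 2 * p + q = r * P.
    apply: (@integral_ratio (x + x')) => //; first exact: integral_add.
    by rewrite mulrDr ex ex'; ring.
  have [N eN] : exists N : int, p ^+ 2 + p * q - e * q ^+ 2 = r ^+ 2 * N.
    apply: (@integral_ratio (x * x')); rewrite ?expf_neq0 //; first exact: integral_mul.
    transitivity ((r%:~R * x) * (r%:~R * x')); first by ring.
    rewrite ex ex'; apply/eqP; rewrite -subr_eq0; apply/eqP.
    transitivity (- q%:~R ^+ 2 * (w ^+ 2 - (w + e%:~R))); first by ring.
    by rewrite w_sqr subrr mulr0.
  have /dvdzP[Q eQ] : (r %| q)%Z.
    apply: (squarefree_dvd_sqr sqfree r0); apply/dvdzP; exists (P ^+ 2 - 4 * N).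
    transitivity ((2 * p + q) ^+ 2 - 4 * (p ^+ 2 + p * q - e * q ^+ 2)); first by ring.
    by rewrite eP eN; ring.
  have r20 : r ^+ 2 != 0 by rewrite expf_neq0.
  have eN' : (P - Q) * (P + Q) = 4 * (N + e * Q ^+ 2).
    apply: (mulfI r20).
    transitivity (4 * (r ^+ 2 * N) + 4 * e * (Q * r) ^+ 2 + (r * P - Q * r) ^+ 2
      + 2 * (Q * r) * (r * P - Q * r) - 4 * (r ^+ 2 * N) - 4 * e * (Q * r) ^+ 2); first by ring.
    rewrite -eN -eP eQ; apply/eqP; rewrite -subr_eq0; apply/eqP.
    transitivity (4 * (p ^+ 2 + p * (Q * r) - e * (Q * r) ^+ 2 - r ^+ 2 * N)); first by ring.
    by rewrite -eQ eN subrr mulr0.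
  have [t et] : exists t, P = Q + 2 * t.
    exists ((P - Q) %/ 2)%Z.
    have rge := modz_ge0 (P - Q) (isT : (2 : int) != 0).
    have rlt := ltz_pmod (P - Q) (isT : 0 < (2 : int)).
    have := divz_eq (P - Q) 2; move: ((P - Q) %/ 2)%Z ((P - Q) %% 2)%Z rge rlt => k r1 ? ? eD.
    have eP1 : P = Q + k * 2 + r1 by lia.
    have [r10|r11] : r1 = 0 \/ r1 = 1 by lia.
      by lia.
    by move: eN'; rewrite eP1 r11; nia.
  have ep : p = r * t.
    apply: (@mulfI _ 2) => //.
    transitivity ((2 * p + q) - q); first by ring.
    by rewrite eP eQ et; ring.
  by exists t, Q; apply: (mulfI rK); rewrite ex ep eQ; ring.
have wO : ring_of_integers w.
  have mon : ('X^2 - 'X - e%:P : {poly int}) \is monic.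
    rewrite -addrA monicE lead_coefDl ?lead_coefXn // size_polyXn.
    by rewrite -opprD size_polyN size_XaddC.
  exists ('X^2 - 'X - e%:P) => //; apply/rootP.
  rewrite !rmorphB /= map_polyXn map_polyX map_polyC /= !hornerE.
  by rewrite w_sqr; ring.
apply: integral_add; first exact: integral_id.
by apply: integral_mul => //; exact: integral_id.
Qed.

(* With [w = (1 + sqrt d) / 2], this is the lattice of the forms with [b = 2 j + 1]. *)
Definition lat (a j : int) : set K :=
  [set x | exists u v : int, x = u%:~R * a%:~R + v%:~R * (j%:~R + w)].

(** [j + w] has norm [j^2 + j - e], so the hypothesis says that this norm is [- a c]. It is also
    [b^2 + 4 a c = d] for [b = 2 j + 1]. *)
Lemma lat_mulw (a j c : int) x : a * c = e - j ^+ 2 - j -> lat a j x -> lat a j (w * x).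
Proof.
move=> ac [u [v ->]]; exists (- u * j + v * c), (u * a + v * (j + 1)).
apply/eqP; rewrite -subr_eq0; apply/eqP.
transitivity (v%:~R * (w ^+ 2 - (w + e%:~R)) + v%:~R * (e - j ^+ 2 - j - a * c)%:~R).
  by ring.
by rewrite w_sqr ac !subrr !mulr0 addr0.
Qed.

Lemma latD a j x y : lat a j x -> lat a j y -> lat a j (x + y).
Proof. by move=> [u [v ->]] [u' [v' ->]]; exists (u + u'), (v + v'); ring. Qed.

Lemma lat_mulz a j (k : int) x : lat a j x -> lat a j (k%:~R * x).
Proof. by move=> [u [v ->]]; exists (k * u), (k * v); ring. Qed.

Lemma lat_fractional (a j c : int) : a != 0 -> a * c = e - j ^+ 2 - j ->
  fractional_ideal (lat a j).
Proof.
move=> a0 ac; split.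
- by exists 0, 0; rewrite !mul0r addr0.
- exact: latD.
- move=> y x /ring_of_integersE[p [q ->]] Ix; rewrite mulrDl; apply: latD; first exact: lat_mulz.
  by rewrite -mulrA; apply: lat_mulz; apply: (lat_mulw ac Ix).
- exists a%:~R; last exact: intr_neq0_quad a0.
  by exists 1, 0; ring.
- exists 1; split; [by apply/ring_of_integersE; exists 1, 0; ring | exact: oner_neq0 |].
  by move=> _ [u [v ->]]; apply/ring_of_integersE; exists (u * a + v * j), v; ring.
Qed.

Lemma lat_shift (a j k : int) : lat a (j + k * a) = lat a j.
Proof.
apply/seteqP; split=> _ [u [v ->]].
  by exists (u + v * k), v; ring.
by exists (u - v * k), v; ring.
Qed.

Lemma latN (a j : int) : lat (- a) j = lat a j.
Proof. by apply/seteqP; split=> _ [u [v ->]]; exists (- u), v; ring. Qed.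

(** The multiplier is the conjugate of [j + w] over [a]: it sends [a] to [- ((- j - 1) + w)] and
    [j + w] to [- c]. *)
Lemma lat_swap (a j c : int) : a != 0 -> a * c = e - j ^+ 2 - j ->
  ideal_equiv (lat a j) (lat c (- j - 1)).
Proof.
move=> a0 ac; have aK := intr_neq0_quad a0.
have x0 : (j%:~R + 1 - w) / a%:~R != 0.
  rewrite mulf_neq0 ?invr_eq0 //; apply/eqP => E.
  have [|_ /eqP] := quad_basis_inj (p := j + 1) (q := -1) (p' := 0) (q' := 0); last by [].
  by transitivity (j%:~R + 1 - w); [ring | rewrite E; ring].
exists ((j%:~R + 1 - w) / a%:~R) => //.
have mul u v : (j%:~R + 1 - w) / a%:~R * (u%:~R * a%:~R + v%:~R * (j%:~R + w)) =
   (- v)%:~R * c%:~R + (- u)%:~R * ((- j - 1)%:~R + w).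
  apply: (mulIf aK); rewrite mulrAC divfK //.
  apply/eqP; rewrite -subr_eq0; apply/eqP.
  transitivity (v%:~R * (a * c - (e - j ^+ 2 - j))%:~R - v%:~R * (w ^+ 2 - (w + e%:~R))).
    by ring.
  by rewrite w_sqr ac; ring.
apply/seteqP; split=> [_ [u [v ->]]|_ [_ [u [v ->]] <-]].
  by exists ((- v)%:~R * a%:~R + (- u)%:~R * (j%:~R + w)); [exists (- v), (- u) | rewrite mul; ring].
by exists (- v), (- u); rewrite mul.
Qed.

(** Hermite normal form of the coordinates of [c J]: [g] generates the coefficients of [w], and [A]
    the elements without [w]. Dividing by [g] leaves a lattice [lat a j]. *)
Lemma fractional_lat (J : set K) : fractional_ideal J ->
  exists a j c : int, [/\ a != 0, a * c = e - j ^+ 2 - j & ideal_equiv (lat a j) J].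
Proof.
move=> [_ JD JM [x0 Jx0 x0_neq0] [c [cO c0 cJ]]].
have intO k : ring_of_integers (k%:~R : K) by apply/ring_of_integersE; exists k, 0; ring.
have wO : ring_of_integers w by apply/ring_of_integersE; exists 0, 1; ring.
pose I (p q : int) := J ((p%:~R + q%:~R * w) / c).
have Jcoord x : J x -> exists p q, c * x = p%:~R + q%:~R * w /\ I p q.
  move=> Jx; have /ring_of_integersE[p [q E]] := cJ x Jx.
  by exists p, q; split=> //; rewrite /I -E mulrAC divff ?mul1r.
have IB p q p' q' : I p q -> I p' q' -> I (p - p') (q - q').
  move=> Ipq Ipq'; have := JD _ _ Ipq (JM _ _ (intO (-1)) Ipq').
  by rewrite /I mulrA -mulrDl; congr (J (_ / c)); ring.
have Iw p q : I p q -> I (q * e) (p + q).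
  move=> /(JM _ _ wO); rewrite /I mulrA; congr (J (_ / c)).
  apply/eqP; rewrite -subr_eq0; apply/eqP.
  transitivity (q%:~R * (w ^+ 2 - (w + e%:~R))); first by ring.
  by rewrite w_sqr subrr mulr0.
have Iz k p q : I p q -> I (k * p) (k * q).
  move=> /(JM _ _ (intO k)); rewrite /I mulrA; congr (J (_ / c)); ring.
have [p1 [q1 [E1 I1]]] := Jcoord _ Jx0.
have [p2 [q2 [q2_neq0 I2]]] : exists p q, q != 0 /\ I p q.
  have [q10|] := eqVneq q1 0; last by exists p1, q1.
  exists (q1 * e), (p1 + q1); split; last exact: Iw.
  rewrite q10 addr0; apply: contra_neq x0_neq0 => p10.
  by apply: (mulfI c0); rewrite E1 p10 q10; ring.
have [g [g0 [p0 Ig] gP]] : exists g : int,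
    [/\ 0 < g, (exists p, I p g) & forall q, (exists p, I p q) -> exists v, q = g * v].
  apply: (@int_subgroup_gen (fun q => exists p, I p q) q2) => //; first by exists p2.
  by move=> q q' [p Ip] [p' Ip']; exists (p - p'); apply: IB.
have [A [A0 IA AP]] : exists A : int,
    [/\ 0 < A, I A 0 & forall p, I p 0 -> exists v, p = A * v].
  (* The witness is [q2] times the norm of [p2 + q2 w], obtained by eliminating [w] between this
     element and its product by [w]. *)
  apply: (@int_subgroup_gen (fun p => I p 0) (q2 * (p2 ^+ 2 + p2 * q2 - q2 ^+ 2 * e) )).
  - rewrite mulf_neq0 //; apply/eqP => E.
    have /eqP : (p2%:~R + q2%:~R * w) * ((p2 + q2)%:~R + (- q2)%:~R * w) = 0.
      transitivity ((p2 ^+ 2 + p2 * q2 - q2 ^+ 2 * e)%:~R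
        - q2%:~R ^+ 2 * (w ^+ 2 - (w + e%:~R))); first by ring.
      by rewrite E w_sqr; ring.
    rewrite mulf_eq0 => /orP[] /eqP /quad_basis_free [_ /eqP].
      by rewrite (negPf q2_neq0).
    by rewrite oppr_eq0 (negPf q2_neq0).
  - have := IB _ _ _ _ (Iz (q2 * (p2 + q2)) _ _ I2) (Iz (q2 * q2) _ _ (Iw _ _ I2)).
    by congr (I _ _); ring.
  - by move=> p p' Ip Ip'; have := IB _ _ _ _ Ip Ip'; rewrite subrr.
(* Stability under [w]: the products of [A] and [p0 + g w] by [w] have [w]-coefficients [A] and
   [p0 + g], so [g] divides [A] and [p0]. *)
have [a Aa] : exists a, A = g * a by apply: gP; exists (0 * e); have := Iw _ _ IA; rewrite addr0.
have [j p0j] : exists j, p0 = g * j.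
  have [v ev] : exists v, p0 + g = g * v by apply: gP; exists (g * e); apply: Iw.
  by exists (v - 1); rewrite mulrBr -ev; ring.
have [c' ac] : exists c', g * (e - j ^+ 2 - j) = A * c'.
  apply: AP; have := IB _ _ _ _ (Iw _ _ Ig) (Iz (j + 1) _ _ Ig).
  by congr (I _ _); rewrite p0j; ring.
have a0 : a != 0 by apply: contraTneq A0 => a0; rewrite Aa a0 mulr0 ltxx.
exists a, j, c'; split=> //.
  by apply: (mulfI (lt0r_neq0 g0)); rewrite mulrA -Aa.
have gK : g%:~R != 0 :> K by apply: intr_neq0_quad; apply: lt0r_neq0.
exists (g%:~R / c); first by rewrite mulf_neq0 ?invr_eq0.
have Ilat u v : I (u * A + v * p0) (v * g).
  have := IB _ _ _ _ (Iz u _ _ IA) (Iz (- v) _ _ Ig).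
  by congr (I _ _); ring.
have E u v : g%:~R / c * (u%:~R * a%:~R + v%:~R * (j%:~R + w)) =
    ((u * A + v * p0)%:~R + (v * g)%:~R * w) / c.
  by rewrite mulrAC Aa p0j; congr (_ / c); ring.
apply/seteqP; split=> [x Jx|_ [_ [u [v ->]] <-]]; last by rewrite E; exact: Ilat.
have [p [q [Ex Ipq]]] := Jcoord _ Jx.
have [v ev] := gP q (ex_intro _ p Ipq).
have [u eu] : exists u, p - v * p0 = A * u.
  apply: AP; have := IB _ _ _ _ Ipq (Iz v _ _ Ig).
  by rewrite ev [v * g]mulrC subrr.
exists (u%:~R * a%:~R + v%:~R * (j%:~R + w)); first by exists u, v.
rewrite E; apply: (mulfI c0); rewrite Ex mulrCA divff // mulr1.
by rewrite ev [u * A]mulrC -eu; congr (_%:~R + _%:~R * w); ring.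
Qed.

(** The rows [(x, y)] and [(z, u)] are the coordinates of [l a] and [l (j + w)] in the second basis,
    invertible because the lattices coincide. Computing [l a (j + w)] in two ways eliminates [l]. *)
Lemma lat_equiv_matrix (a j c a' j' c' : int) :
  a * c = e - j ^+ 2 - j -> a' * c' = e - j' ^+ 2 - j' -> a' != 0 ->
  ideal_equiv (lat a j) (lat a' j') -> exists x y z u : int,
  [/\ x * u - y * z = 1 \/ x * u - y * z = -1,
      a * u = x * a' + y * (j + j' + 1)
    & a * z = x * (j - j') + y * c'].
Proof.
move=> ac ac' a0' [l l0 E].
have lin (x y x' y' : int) : x%:~R * a'%:~R + y%:~R * (j'%:~R + w) =
    x'%:~R * a'%:~R + y'%:~R * (j'%:~R + w) -> x = x' /\ y = y'.
  move=> H; have [|Ex Ey] := quad_basis_inj (p := x * a' + y * j') (q := y)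
    (p' := x' * a' + y' * j') (q' := y').
    by apply/eqP; rewrite -subr_eq0; apply/eqP; move/eqP: H; rewrite -subr_eq0 => /eqP <-; ring.
  by split=> //; apply: (mulIf a0'); move: Ex; rewrite Ey => /addIr.
have in1 : lat a' j' (l * a%:~R) by rewrite E; exists a%:~R => //; exists 1, 0; ring.
have in2 : lat a' j' (l * (j%:~R + w)) by rewrite E; exists (j%:~R + w) => //; exists 0, 1; ring.
have [x [y E1]] := in1; have [z [u E2]] := in2.
have in3 : lat a' j' a'%:~R by exists 1, 0; ring.
have in4 : lat a' j' (j'%:~R + w) by exists 0, 1; ring.
move: in3 in4; rewrite E => -[_ [x' [y' ->]] E3] [_ [z' [u' ->]] E4].
have mul v t : l * (v%:~R * a%:~R + t%:~R * (j%:~R + w)) =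
    (v * x + t * z)%:~R * a'%:~R + (v * y + t * u)%:~R * (j'%:~R + w).
  transitivity (v%:~R * (l * a%:~R) + t%:~R * (l * (j%:~R + w))); first by ring.
  by rewrite E1 E2; ring.
have [xx xy] : x' * x + y' * z = 1 /\ x' * y + y' * u = 0.
  by apply: lin; rewrite -mul E3; ring.
have [zx zy] : z' * x + u' * z = 0 /\ z' * y + u' * u = 1.
  by apply: lin; rewrite -mul E4; ring.
have det : (x' * u' - y' * z') * (x * u - y * z) = 1.
  transitivity ((x' * x + y' * z) * (z' * y + u' * u)
     - (x' * y + y' * u) * (z' * x + u' * z)); first by ring.
  by rewrite xx xy zx zy; ring.
have [Ec Ew] : (z * a' + u * j') * a = (x * a' + y * j') * j + y * e /\
    u * a = x * a' + y * (j + j' + 1).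
  apply: quad_basis_inj; transitivity ((z%:~R * a'%:~R + u%:~R * (j'%:~R + w)) * a%:~R).
    by ring.
  rewrite -E2 mulrAC -mulrA; transitivity (l * a%:~R * (j%:~R + w)); first by ring.
  rewrite E1; apply/eqP; rewrite -subr_eq0; apply/eqP.
  transitivity (y%:~R * (w ^+ 2 - (w + e%:~R))); first by ring.
  by rewrite w_sqr subrr mulr0.
have det1 : x * u - y * z = 1 \/ x * u - y * z = -1.
  move: (congr1 absz det); rewrite abszM => /eqP; rewrite muln_eq1 => /andP[_ /eqP].
  by move: (x * u - y * z) => D; lia.
exists x, y, z, u; split; [exact: det1 | by rewrite mulrC |].
apply: (mulfI a0'); transitivity ((z * a' + u * j') * a - j' * (u * a)); first by ring.
rewrite Ec Ew; transitivity (a' * x * (j - j') + y * (e - j' ^+ 2 - j')); first by ring.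
by rewrite -ac'; ring.
Qed.

Hypothesis e_gt0 : 0 < e.

(** Translate [j] to its residue [i] modulo [a]. If the new [c1] is negative, then
    [- a c1 = i^2 + i - e < a^2], so exchanging the basis vectors decreases the absolute value of
    [a]. *)
Lemma lat_reduce (a j c : int) : a != 0 -> a * c = e - j ^+ 2 - j ->
  exists a' j' c' : int, simple_form (4 * e + 1) a' (2 * j' + 1) c' /\
    ideal_equiv (lat a j) (lat a' j').
Proof.
have [k] := ubnP `|a|%N; elim: k a j c => // k IH a j c lek a0 ac.
wlog ap : a c lek a0 ac / 0 < a.
  move=> wl; have [an|ap|E] := ltrgtP a 0; last by rewrite E in a0.
    by rewrite -latN; apply: (wl (- a) (- c)); rewrite ?oppr_eq0 //; lia.
  exact: (wl a c).
have eD := divz_eq j a; have rge := modz_ge0 j a0; have rlt := ltz_pmod j ap.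
move: (j %/ a)%Z (j %% a)%Z eD rge rlt => t i ej i0 ia.
have lji : lat a j = lat a i by rewrite ej addrC lat_shift.
pose c1 := c + t * (2 * i + t * a + 1).
have ac1 : a * c1 = e - i ^+ 2 - i by rewrite /c1 mulrDr ac ej; ring.
have [c1n|c1p|c10] := ltrgtP c1 0; last first.
- case/negP: (nonsquare (2 * i + 1)); apply/eqP.
  rewrite c10 mulr0 in ac1; have -> : e = i ^+ 2 + i by lia.
  by ring.
- exists a, i, c1; rewrite lji; split; last exact: ideal_equiv_refl.
  by split=> //; rewrite ac1; ring.
have c1a : - c1 < a.
  rewrite ltNge; apply/negP => le.
  have : a * a <= a * - c1 by rewrite ler_pM2l.
  have : i * i <= i * (a - 1) by rewrite ler_wpM2l //; lia.
  by nia.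
have c10 : c1 != 0 by lia.
have [|//||a' [j' [c' [sf eq]]]] := IH (- c1) (- i - 1) (- a).
- lia.
- by rewrite oppr_eq0.
- by rewrite mulrNN mulrC ac1; ring.
exists a', j', c'; split=> //; apply: ideal_equiv_trans eq.
by rewrite lji latN; apply: lat_swap.
Qed.
Lemma fractional_simple (J : set K) : fractional_ideal J ->
  exists a j c : int, simple_form (4 * e + 1) a (2 * j + 1) c /\
    ideal_equiv (lat a j) J.
Proof.
move=> /fractional_lat[a [j [c [a0 ac eqJ]]]].
have [a' [j' [c' [sf eq]]]] := lat_reduce a0 ac.
exists a', j', c'; split=> //.
exact: ideal_equiv_trans (ideal_equiv_sym eq) eqJ.
Qed.

End QuadraticField.

(** * Divisor sums *)

Definition known_list (m a b c : int) : Prop :=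
  [\/ unit_list m a b c, two_list m a b c | two_list m a (- b) c].

(* [(d - b^2) / 8] for [b = 2 (k - 2 m) + 1]; these are the odd [b] with
   [b^2 < d] when [k < 4 m]. *)
Definition half_norm (m k : nat) : nat := (m + (k * (4 * m - 1 - k))./2)%N.

(** The listed forms with neither [a] nor [c] in [{1, 2}]. The three tests on [k] mean [b = 1] or
    [-1], [b = 2 m - 1] or its opposite, and [b = 2 m + 1] or its opposite. *)
Definition extra_divisors (m k : nat) : seq nat :=
  if (k == 2 * m)%N || (k == 2 * m - 1)%N then [:: m; 2 * m; 4 * m]%N
  else if (k == 3 * m - 1)%N || (k == m) then [:: m; 3 * m + 1]%N
  else if (k == 3 * m)%N || (k == m - 1)%N then [:: m; 3 * m - 1]%N
  else [::].

(** Since [a c = 2 * half_norm m k], the first four entries are [a = 1], [a = 2], [c = 2], [c = 1];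
    they occur for every [b]. *)
Definition known_divisors (m k : nat) : seq nat :=
  [:: 1; 2; half_norm m k; 2 * half_norm m k]%N ++ extra_divisors m k.

Lemma half_normE (m k : nat) : (k < 4 * m)%N ->
  ((half_norm m k)%:Z * 8 = 16 * m%:Z ^+ 2 + 1 - (2 * (k%:Z - 2 * m%:Z) + 1) ^+ 2).
Proof.
move=> km; rewrite /half_norm.
(* [k] and [4 m - 1 - k] have opposite parity, so the halving is exact. *)
have ev : ~~ odd (k * (4 * m - 1 - k)).
  rewrite oddM oddB; last by lia.
  rewrite oddB; last by lia.
  by rewrite oddM /=; case: (odd k).
have := even_halfK ev; rewrite -mul2n; set h := _./2 => E.
rewrite PoszD mulrDl (_ : h%:Z * 8 = 4 * ((2 * h)%N : int)); last by rewrite PoszM; ring.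
rewrite E PoszM (_ : (4 * m - 1 - k)%N%:Z = 4 * m%:Z - 1 - k%:Z); last by lia.
ring.
Qed.

Lemma simple_form_half_norm (m k a c : nat) : (k < 4 * m)%N ->
  simple_form (16 * m%:Z ^+ 2 + 1) a (2 * (k%:Z - 2 * m%:Z) + 1) c <->
  (a * c = 2 * half_norm m k /\ 0 < half_norm m k)%N.
Proof.
move=> km; have E := half_normE km; split=> [[a0 c0 disc]|[ac h0]].
  by split; [nia | nia].
by split; [nia | nia | nia].
Qed.

Lemma half_norm_ge (m k : nat) : (m <= half_norm m k)%N.
Proof. exact: leq_addr. Qed.

Lemma known_divisors_list (m k a c : nat) : (k < 4 * m)%N ->
  (a * c = 2 * half_norm m k)%N ->
  a \in known_divisors m k -> known_list m a (2 * (k%:Z - 2 * m%:Z) + 1) c.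
Proof.
move=> km ac; have E := half_normE km; have hm := half_norm_ge m k.
set h := half_norm m k in ac E hm *.
rewrite /known_divisors -/h mem_cat => /orP[].
  rewrite !inE => /or4P[] /eqP ea.
  - by constructor 1; constructor 1; lia.
  (* The parity of [k] is the class of [b] modulo 4, which decides between the two conjugate
     cycles. *)
  - have [t [et|et]] : exists t : int, (k%:Z = 2 * t \/ k%:Z = 2 * t + 1).
      by exists (k./2)%:Z; have := odd_double_half k; case: (odd k); lia.
    + by constructor 2; constructor 1; split; [lia | exists (t - m%:Z); lia].
    + by constructor 3; constructor 1; split; [lia | exists (m%:Z - t - 1); lia].
  - have ec : c = 2%N by nia.
    have [t [et|et]] : exists t : int, (k%:Z = 2 * t \/ k%:Z = 2 * t + 1).
      by exists (k./2)%:Z; have := odd_double_half k; case: (odd k); lia.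
    + by constructor 3; constructor 2; split; [lia | exists (m%:Z - t - 1); lia].
    + by constructor 2; constructor 2; split; [lia | exists (t - m%:Z); lia].
  - have ec : c = 1%N by nia.
    by constructor 1; constructor 2; lia.
have cE x : (a * x = 2 * h)%N -> c = x.
  by move=> e; apply/eqP; rewrite -(@eqn_pmul2l a) ?ac ?e //; nia.
rewrite /extra_divisors; case: ifP => [/orP[] /eqP ek|_].
- have eh : (2 * h = m * (4 * m))%N by nia.
  rewrite !inE => /or3P[] /eqP ea.
  + have ec : c = (4 * m)%N by apply: cE; rewrite ea eh; by [].
    clear E ac eh hm; by constructor 3; constructor 4; constructor 2; split; lia.
  + have ec : c = (2 * m)%N by apply: cE; rewrite ea eh; by ring.
    clear E ac eh hm; by constructor 1; constructor 3; split; lia.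
  + have ec : c = (m)%N by apply: cE; rewrite ea eh; by rewrite mulnC.
    clear E ac eh hm; by constructor 2; constructor 3; constructor 2; split; lia.
- have eh : (2 * h = m * (4 * m))%N by nia.
  rewrite !inE => /or3P[] /eqP ea.
  + have ec : c = (4 * m)%N by apply: cE; rewrite ea eh; by [].
    clear E ac eh hm; by constructor 2; constructor 4; constructor 2; split; lia.
  + have ec : c = (2 * m)%N by apply: cE; rewrite ea eh; by ring.
    clear E ac eh hm; by constructor 1; constructor 3; split; lia.
  + have ec : c = (m)%N by apply: cE; rewrite ea eh; by rewrite mulnC.
    clear E ac eh hm; by constructor 3; constructor 3; constructor 2; split; lia.
case: ifP => [/orP[] /eqP ek|_].
- have eh : (2 * h = m * (3 * m + 1))%N by nia.
  rewrite !inE => /orP[] /eqP ea.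
  + have ec : c = (3 * m + 1)%N by apply: cE; rewrite ea eh; by [].
    clear E ac eh hm; by constructor 2; constructor 4; constructor 1; split; lia.
  + have ec : c = (m)%N by apply: cE; rewrite ea eh; by rewrite mulnC.
    clear E ac eh hm; by constructor 3; constructor 3; constructor 1; split; lia.
- have eh : (2 * h = m * (3 * m + 1))%N by nia.
  rewrite !inE => /orP[] /eqP ea.
  + have ec : c = (3 * m + 1)%N by apply: cE; rewrite ea eh; by [].
    clear E ac eh hm; by constructor 3; constructor 4; constructor 1; split; lia.
  + have ec : c = (m)%N by apply: cE; rewrite ea eh; by rewrite mulnC.
    clear E ac eh hm; by constructor 2; constructor 3; constructor 1; split; lia.
case: ifP => [/orP[] /eqP ek|_] //.
- have eh : (2 * h = m * (3 * m - 1))%N by nia.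
  rewrite !inE => /orP[] /eqP ea.
  + have ec : c = (3 * m - 1)%N by apply: cE; rewrite ea eh; by [].
    clear E ac eh hm; by constructor 3; constructor 4; constructor 3; split; lia.
  + have ec : c = (m)%N by apply: cE; rewrite ea eh; by rewrite mulnC.
    clear E ac eh hm; by constructor 2; constructor 3; constructor 3; split; lia.
- have eh : (2 * h = m * (3 * m - 1))%N by nia.
  rewrite !inE => /orP[] /eqP ea.
  + have ec : c = (3 * m - 1)%N by apply: cE; rewrite ea eh; by [].
    clear E ac eh hm; by constructor 2; constructor 4; constructor 3; split; lia.
  + have ec : c = (m)%N by apply: cE; rewrite ea eh; by rewrite mulnC.
    clear E ac eh hm; by constructor 3; constructor 3; constructor 3; split; lia.
Qed.

Lemma known_list_divisors (m k a c : nat) : (2 < m)%N -> (k < 4 * m)%N ->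
  (a * c = 2 * half_norm m k)%N ->
  known_list m a (2 * (k%:Z - 2 * m%:Z) + 1) c -> a \in known_divisors m k.
Proof.
move=> m2 km ac; have E := half_normE km; have hm := half_norm_ge m k.
set h := half_norm m k in ac E hm *.
rewrite /known_divisors -/h mem_cat; move=> kn; apply/orP.
have e5 : a = (2 * m)%N -> c = (2 * m)%N -> (k == 2 * m)%N || (k == 2 * m - 1)%N.
  move=> ea ec; have : (2 * (k%:Z - 2 * m%:Z) + 1) ^+ 2 = 1.
    have : (2 * h)%:Z = 4 * m%:Z ^+ 2 by rewrite -ac ea ec !PoszM; ring.
    by move: E; rewrite PoszM; lia.
  by move/eqP; rewrite sqrf_eq1; clear; lia.
have split_cases : [\/ a = 1, a = 2, c = 2 | c = 1]%N \/
    [\/ ((k == 2 * m) || (k == 2 * m - 1)) && (a \in [:: m; 2 * m; 4 * m]),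
       ((k == 3 * m - 1) || (k == m)) && (a \in [:: m; 3 * m + 1])
     | ((k == 3 * m) || (k == m - 1)) && (a \in [:: m; 3 * m - 1])]%N.
  rewrite !inE; clear E ac hm; case: kn => [[a1|c1|[a1 c1]]
    |[[a1 _]|[c1 _]|[] [a1 b1 c1]|[] [a1 b1 c1]]
    |[[a1 _]|[c1 _]|[] [a1 b1 c1]|[] [a1 b1 c1]]].
  - by left; constructor 1; lia.
  - by left; constructor 4; lia.
  - by right; constructor 1; lia.
  - by left; constructor 2; lia.
  - by left; constructor 3; lia.
  - by right; constructor 2; lia.
  - by right; constructor 1; lia.
  - by right; constructor 3; lia.
  - by right; constructor 2; lia.
  - by right; constructor 1; lia.
  - by right; constructor 3; lia.
  - by left; constructor 2; lia.
  - by left; constructor 3; lia.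
  - by right; constructor 2; lia.
  - by right; constructor 1; lia.
  - by right; constructor 3; lia.
  - by right; constructor 2; lia.
  - by right; constructor 1; lia.
  - by right; constructor 3; lia.
have a0 : (0 < a)%N by nia.
clear kn e5; case: split_cases => [[] ea|[] /andP[kk ma]]; [left.. | right | right | right].
- by rewrite ea !inE eqxx.
- by rewrite ea !inE eqxx orbT.
- have -> : a = h by apply/eqP; rewrite -(@eqn_pmul2l 2) // -ac ea mulnC.
  by rewrite !inE eqxx !orbT.
- have -> : a = (2 * h)%N by rewrite -ac ea muln1.
  by rewrite !inE eqxx !orbT.
- by rewrite /extra_divisors kk.
- by rewrite /extra_divisors kk ifF //; clear -kk m2; lia.
- by rewrite /extra_divisors kk ifF ?ifF //; clear -kk m2; lia.
Qed.

Lemma ltr_sqrtC_int (t : int) (d : nat) :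
  (`|t%:~R| < sqrtC d%:R :> algC) = (t ^+ 2 < d%:Z).
Proof.
rewrite -(@ltr_pXn2r _ 2) // ?nnegrE ?sqrtC_ge0 ?ler0n // sqrtCK -normrX -rmorphXn /=.
by rewrite ger0_norm ?ler0z ?sqr_ge0 // -[d%:R]/(d%:Z%:~R) ltr_int.
Qed.

(** The congruence selects the odd [t], written [2 (k - 2 m) + 1]; the bound on [t] then means
    [0 <= k < 4 m]. *)
Lemma sigma_sumE (m : nat) : (0 < m)%N -> sigma_sum (16 * m ^ 2 + 1) =
  (\sum_(0 <= k < 4 * m) sigma (2 * half_norm m k))%N.
Proof.
move=> m0; rewrite /sigma_sum; set A := [set t : int | _].
have dE : (16 * m ^ 2 + 1)%N%:Z = 16 * m%:Z ^+ 2 + 1 by lia.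
have -> : A = [set` [seq (2 * (k%:Z - 2 * m%:Z) + 1) | k <- iota 0 (4 * m)]].
  apply/seteqP; split=> t /=.
    rewrite /A /= ltr_sqrtC_int dE => -[lt tm].
    have [q eq] : exists q, t = 2 * q + 1.
      exists (t %/ 2)%Z; move: (divz_eq t 2) (modz_ge0 t (isT : (2 : int) != 0))
        (ltz_pmod t (isT : 0 < (2 : int))) tm.
      move: (t %/ 2)%Z (t %% 2)%Z => q r -> r0 r2.
      have [->|->] : r = 0 \/ r = 1 by lia.
        rewrite (_ : (q * 2 + 0) ^+ 2 = q ^+ 2 * 4 + 0); last by ring.
        rewrite (_ : 16 * m%:Z ^+ 2 + 1 = (4 * m%:Z ^+ 2) * 4 + 1); last by ring.
        by rewrite !modzMDl.
      by lia.
    apply/mapP; exists (absz (q + 2 * m%:Z)); last by rewrite eq in lt *; nia.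
    by rewrite mem_iota; rewrite eq in lt; nia.
  move=> /mapP[k]; rewrite mem_iota add0n => /andP[_ km] ->.
  rewrite /A /= ltr_sqrtC_int dE; split; first nia.
  rewrite (_ : (2 * (k%:Z - 2 * m%:Z) + 1) ^+ 2 =
    ((k%:Z - 2 * m%:Z) ^+ 2 + (k%:Z - 2 * m%:Z)) * 4 + 1); last by ring.
  rewrite (_ : 16 * m%:Z ^+ 2 + 1 = (4 * m%:Z ^+ 2) * 4 + 1); last by ring.
  by rewrite !modzMDl.
rewrite -fsbig_seq; last first.
  by rewrite map_inj_in_uniq ?iota_uniq // => x y _ _; lia.
rewrite big_map /index_iota subn0; apply: eq_big_seq => k; rewrite mem_iota add0n => /andP[_ km].
congr sigma; have := half_normE km; lia.
Qed.

(** For [m = 2] the extra entry [m] repeats the entry 2; for [m > 2] each listed form is counted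
    once. *)
Lemma known_divisors_uniq (m k : nat) : (2 < m)%N -> (k < 4 * m)%N -> uniq (known_divisors m k).
Proof.
move=> m2 km; have E := half_normE km; have hm := half_norm_ge m k.
rewrite /known_divisors; set h := half_norm m k in E hm *.
rewrite cat_uniq; apply/and3P; split.
- by rewrite /= !inE; lia.
- rewrite /extra_divisors; case: ifP => [kk|_].
    have eh : h = (2 * m * m)%N by case/orP: kk => /eqP ek; nia.
    by clear E; rewrite /= !inE; nia.
  case: ifP => [kk|_].
    have eh : (2 * h = m * (3 * m + 1))%N by case/orP: kk => /eqP ek; nia.
    by clear E; rewrite /= !inE; nia.
  case: ifP => [kk|//].
  have eh : (2 * h = m * (3 * m - 1))%N by case/orP: kk => /eqP ek; nia.
  by clear E; rewrite /= !inE; nia.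
- rewrite /extra_divisors; case: ifP => _; first by rewrite /= !inE; lia.
  case: ifP => _; first by rewrite /= !inE; lia.
  by case: ifP => _ //; rewrite /= !inE; lia.
Qed.

Lemma sum_half_norm (m K : nat) : (K <= 4 * m)%N ->
  6 * (\sum_(0 <= k < K) half_norm m k)%N%:Z =
  6 * m%:Z * K%:Z ^+ 2 - (K%:Z - 1) * K%:Z * (K%:Z + 1).
Proof.
elim: K => [|K IH] Km; first by rewrite big_nil; ring.
rewrite big_nat_recr //= PoszD mulrDr IH; last exact: ltnW.
have := half_normE Km; rewrite -addn1 PoszD => E.
apply: (@mulfI _ 4) => //; rewrite mulrDr.
have -> : 4 * (6 * (half_norm m K)%:Z) = 3 * ((half_norm m K)%:Z * 8) by ring.
rewrite E; ring.
Qed.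

Lemma sum_indicator (K i v : nat) : (i < K)%N ->
  (\sum_(0 <= k < K) (k == i) * v = v)%N.
Proof.
move=> iK; rewrite (eq_bigr (fun k => if k == i then v else 0)%N); last first.
  by move=> k _; case: eqP; rewrite ?mul1n.
by rewrite -big_mkcond big_nat1_eq iK.
Qed.

(** For [m > 1] the six special indices are distinct, so no branch of the nested test hides another;
    they contribute [2 (7 m) + 2 (4 m + 1) + 2 (4 m - 1)]. *)
Lemma sum_extra_divisors (m : nat) : (1 < m)%N ->
  (\sum_(0 <= k < 4 * m) \sum_(e <- extra_divisors m k) e = 30 * m)%N.
Proof.
move=> m1.
have E k : (\sum_(e <- extra_divisors m k) e =
    (k == 2 * m) * (7 * m) + (k == 2 * m - 1) * (7 * m) +
    (k == 3 * m - 1) * (4 * m + 1) + (k == m) * (4 * m + 1) +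
    (k == 3 * m) * (4 * m - 1) + (k == m - 1) * (4 * m - 1))%N.
  rewrite /extra_divisors.
  have [e1|n1] := eqVneq k (2 * m)%N.
    by rewrite /= !big_cons big_nil; lia.
  have [e2|n2] := eqVneq k (2 * m - 1)%N.
    by rewrite /= !big_cons big_nil; lia.
  have [e3|n3] := eqVneq k (3 * m - 1)%N.
    by rewrite /= !big_cons big_nil; lia.
  have [e4|n4] := eqVneq k m.
    by rewrite /= !big_cons big_nil; lia.
  have [e5|n5] := eqVneq k (3 * m)%N.
    by rewrite /= !big_cons big_nil; lia.
  have [e6|n6] := eqVneq k (m - 1)%N.
    by rewrite /= !big_cons big_nil; lia.
  by rewrite /= big_nil.
under eq_bigr do rewrite E.
by rewrite !big_split /= !sum_indicator; lia.
Qed.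

(** The entries 1 and 2 give [12 m], the two multiples of [half_norm] give [16 m^3 + 2 m], and the
    extra entries give [30 m]. *)
Lemma sum_known_divisors (m : nat) : (1 < m)%N ->
  (\sum_(0 <= k < 4 * m) \sum_(e <- known_divisors m k) e = 16 * m ^ 3 + 44 * m)%N.
Proof.
move=> m1.
under eq_bigr => k _ do rewrite big_cat /= !big_cons big_nil.
rewrite big_split /= sum_extra_divisors //.
have -> : (\sum_(0 <= k < 4 * m) (1 + (2 + (half_norm m k + (2 * half_norm m k + 0)))) =
    3 * (4 * m) + 3 * \sum_(0 <= k < 4 * m) half_norm m k)%N.
  have <- : (\sum_(0 <= k < 4 * m) 3 = 3 * (4 * m))%N by rewrite sum_nat_const_nat; lia.
  rewrite big_distrr -big_split /=.
  by apply: eq_bigr => k _; lia.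
have := sum_half_norm (leqnn (4 * m)); rewrite -[(m ^ 3)%N]/(m * (m * m))%N; lia.
Qed.

Lemma dvdn_known_divisors (m k e : nat) : (k < 4 * m)%N ->
  e \in known_divisors m k -> (e %| 2 * half_norm m k)%N.
Proof.
move=> km; have E := half_normE km; set h := half_norm m k in E *.
rewrite /known_divisors -/h mem_cat => /orP[].
  rewrite !inE => /or4P[] /eqP ->; [exact: dvd1n | exact: dvdn_mulr | | exact: dvdnn].
  exact: dvdn_mull.
rewrite /extra_divisors; case: ifP => [kk|_].
  have eh : (2 * h = 4 * m * m)%N by case/orP: kk => /eqP ek; nia.
  rewrite eh !inE => /or3P[] /eqP ->; apply/dvdnP.
  - by exists (4 * m)%N.
  - by exists (2 * m)%N; lia.
  - by exists m; lia.
case: ifP => [kk|_].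
  have eh : (2 * h = m * (3 * m + 1))%N by case/orP: kk => /eqP ek; nia.
  by rewrite eh !inE => /orP[] /eqP ->; [apply: dvdn_mulr | apply: dvdn_mull].
case: ifP => [kk|//].
have eh : (2 * h = m * (3 * m - 1))%N by case/orP: kk => /eqP ek; nia.
by rewrite eh !inE => /orP[] /eqP ->; [apply: dvdn_mulr | apply: dvdn_mull].
Qed.

Lemma sigma_known_divisors (m k : nat) : (2 < m)%N -> (k < 4 * m)%N ->
  sigma (2 * half_norm m k) = (\sum_(e <- known_divisors m k) e +
    \sum_(e <- divisors (2 * half_norm m k) | e \notin known_divisors m k) e)%N.
Proof.
move=> m2 km; have hm := half_norm_ge m k.
rewrite /sigma (bigID (mem (known_divisors m k))) /=; congr (_ + _)%N.
rewrite -big_filter; apply: perm_big; apply: uniq_perm.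
- by rewrite filter_uniq // divisors_uniq.
- exact: known_divisors_uniq.
move=> e; rewrite mem_filter /=; case ek: (e \in known_divisors m k) => //=.
rewrite -dvdn_divisors; last by lia.
exact: dvdn_known_divisors.
Qed.

Lemma simple_form_index (m : nat) (a b c : int) : (0 < m)%N ->
  simple_form (16 * m%:Z ^+ 2 + 1) a b c -> exists k a' c' : nat,
  [/\ (k < 4 * m)%N, (a' * c' = 2 * half_norm m k)%N, (0 < half_norm m k)%N &
     [/\ a = a', b = 2 * (k%:Z - 2 * m%:Z) + 1 & c = c']].
Proof.
move=> m0 sf; have [[j ej] bm] := form_odd (m0 : 0 < m%:Z) sf.
have [a' ea] : exists a', a = Posz a' by exists (absz a); case: sf; lia.
have [c' ec] : exists c', c = Posz c' by exists (absz c); case: sf; lia.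
pose k := absz (j + 2 * m%:Z).
have km : (k < 4 * m)%N by rewrite /k; lia.
have bk : b = 2 * (k%:Z - 2 * m%:Z) + 1 by rewrite /k; lia.
exists k, a', c'; rewrite bk ea ec in sf.
by have [ac h0] := (simple_form_half_norm a' c' km).1 sf.
Qed.

(** The surplus over [16 m^3 + 44 m] is a sum of positive divisors, one for each unlisted form. *)
Lemma sigma_sum_known (m : nat) : (2 < m)%N ->
  sigma_sum (16 * m ^ 2 + 1) = (16 * m ^ 3 + 44 * m)%N <->
  (forall a b c : int, simple_form (16 * m%:Z ^+ 2 + 1) a b c -> known_list m a b c).
Proof.
move=> m2.
have -> : sigma_sum (16 * m ^ 2 + 1) = (16 * m ^ 3 + 44 * m + \sum_(0 <= k < 4 * m)
    \sum_(e <- divisors (2 * half_norm m k) | e \notin known_divisors m k) e)%N.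
  rewrite sigma_sumE; last by lia.
  rewrite -sum_known_divisors; last by lia.
  rewrite -big_split; apply: eq_big_nat => k /andP[_ km].
  exact: sigma_known_divisors.
split=> [sum0 a b c sf|all_known].
  have [|k [a' [c' [km ac h0 [-> -> ->]]]]] := simple_form_index _ sf; first lia.
  apply: (known_divisors_list km ac); apply/negPn/negP => nk.
  have /eqP : (\sum_(0 <= k < 4 * m) \sum_(e <- divisors (2 * half_norm m k)
     | e \notin known_divisors m k) e = 0)%N by lia.
  rewrite sum_nat_seq_eq0 => /allP/(_ k); rewrite mem_index_iota km => /(_ isT) /=.
  rewrite sum_nat_seq_eq0 => /allP/(_ a'); rewrite -dvdn_divisors; last by lia.
  rewrite -ac dvdn_mulr // nk => /(_ isT) /= /eqP a0.
  by move: ac; rewrite a0 mul0n; lia.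
rewrite big_nat big1 ?addn0 // => k /andP[_ km].
rewrite big_seq_cond big1 // => e; rewrite -dvdn_divisors; last first.
  by have := half_norm_ge m k; lia.
move=> /andP[/dvdnP[c ec] /negP[]].
apply: (known_list_divisors m2 km (c := c)); first by rewrite ec mulnC.
apply: all_known; apply/simple_form_half_norm => //; split; first by rewrite ec mulnC.
by have := half_norm_ge m k; lia.
Qed.

Lemma simple_form_small (m : nat) (a b c : int) : (m == 1)%N || (m == 2)%N ->
  simple_form (16 * m%:Z ^+ 2 + 1) a b c -> known_list m a b c.
Proof.
move=> m12 sf.
have [|k [a' [c' [km ac h0 [-> -> ->]]]]] := simple_form_index _ sf; first lia.
apply: (known_divisors_list km ac).
have all_known : all (fun k => all (mem (known_divisors m k)) (divisors (2 * half_norm m k)))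
    (iota 0 (4 * m)) by case/orP: m12 => /eqP ->; vm_compute.
move/allP: all_known => /(_ k); rewrite mem_iota km => /(_ isT) /allP; apply.
by rewrite -dvdn_divisors -?ac ?dvdn_mulr //; lia.
Qed.

Lemma sigma_sum_65 : sigma_sum 65 = 160%N.
Proof. by rewrite (@sigma_sumE 2) // /sigma unlock; vm_compute. Qed.

(** * Class number *)

Lemma card_fset_set3 (T : choiceType) (A : set T) (x y z : T) :
  y <> x -> z <> x -> z <> y -> A x -> A y -> A z ->
  #|` fset_set A| = 3%N <-> A = [set x; y; z].
Proof.
move=> yx zx zy Ax Ay Az; pose S := [fset x; y; z]%fset.
have SE : [set` S] = [set x; y; z].
  apply/seteqP; split=> t; rewrite /= !inE.
    by move=> /orP[/orP[]|] /eqP ->; [left; left|left; right|right].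
  by move=> [[->|->]|->]; rewrite eqxx ?orbT.
have cS : #|` S| = 3%N.
  rewrite /S fsetUC cardfsU1 cardfs2 !inE.
  have [/eqP|_] := eqVneq z x; first by move/eqP.
  have [/eqP|_] := eqVneq z y; first by move/eqP.
  by have [e|_] := eqVneq x y; first by case: yx.
split=> [c3|->]; last by rewrite -SE set_fsetK.
(* An infinite set would have [fset_set] empty, hence cardinality 0. *)
have fA : finite_set A.
  by move: c3; rewrite /fset_set; case: pselect => //; rewrite cardfs0.
have sub : (S `<=` fset_set A)%fset.
  apply/fsubsetP => t tS; rewrite in_fset_set //; apply/mem_set.
  by move: tS; rewrite !inE => /orP[/orP[]|] /eqP ->.
rewrite -SE -[LHS]fset_setK //; rewrite (_ : fset_set A = S) //; apply/esym/eqP.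
by rewrite eqEfcard sub c3 cS.
Qed.

(* Any function invariant under translation and under exchanging the two basis
   vectors; applied to the ideal class, and to the ideal class of the conjugate. *)
Section ListInvariants.
Variables (T : Type) (F : int -> int -> T) (m : int).
Hypothesis m_gt0 : 0 < m.
Let d := 16 * m ^+ 2 + 1.
Hypothesis F_shift : forall a b c k, simple_form d a b c -> F a (b + 2 * k * a) = F a b.
Hypothesis F_swap : forall a b c, simple_form d a b c -> F c (- b) = F a b.

Lemma unit_list_invariant a b c : simple_form d a b c -> unit_list m a b c -> F a b = F 1 1.
Proof.
have one b' c' : simple_form d 1 b' c' -> F 1 b' = F 1 1.
  move=> sf; have [[k ek] _] := form_odd m_gt0 sf.
  by rewrite -(F_shift (- k) sf) ek; congr (F 1 _); ring.
have c_one a' b' : simple_form d a' b' 1 -> F a' b' = F 1 1.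
  move=> sf; rewrite -(F_swap sf); apply: (one _ a'); case: sf => ? ? <-.
  by split=> //; ring.
move=> sf [a1|c1|[a1 c1]].
- by rewrite a1 in sf *; exact: one sf.
- by rewrite c1 in sf; exact: c_one sf.
rewrite a1 c1 in sf *.
have /eqP : b ^+ 2 = 1 by case: sf; rewrite /d => _ _; lia.
(* Translating [(2 m, 1, 2 m)] by -1, or [(2 m, -1, 2 m)] by 1, yields a form with [c = 1]. *)
rewrite sqrf_eq1 => /orP[] /eqP eb; rewrite eb in sf *.
  rewrite -(F_shift (-1) sf); apply: c_one; rewrite /d; split; lia.
rewrite -(F_shift 1 sf); apply: c_one; rewrite /d; split; lia.
Qed.

Lemma two_list_invariant a b c : simple_form d a b c -> two_list m a b c -> F a b = F 2 1.
Proof.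
have two b' c' k : simple_form d 2 b' c' -> b' = 4 * k + 1 -> F 2 b' = F 2 1.
  by move=> sf ek; rewrite -(F_shift (- k) sf) ek; congr (F 2 _); ring.
have c_two a' b' k : simple_form d a' b' 2 -> b' = 4 * k + 3 -> F a' b' = F 2 1.
  move=> sf ek; rewrite -(F_swap sf); apply: (two _ a' (- k - 1)); last by rewrite ek; ring.
  by case: sf => ? ? <-; split=> //; ring.
(* The three forms with [a = m] are translates of each other; exchanging this one and translating by
   -1 leads to [c = 2], [b = 3 - 4 m]. *)
have sf1 : simple_form d m (- 2 * m - 1) (3 * m - 1) by rewrite /d; split; lia.
have F1 : F m (- 2 * m - 1) = F 2 1.
  rewrite -(F_swap sf1) -(@F_shift _ _ m (-1)); last by rewrite /d; split; lia.
  by apply: (@c_two _ _ (- m)); rewrite /d; [split|]; lia.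
have sf2 : simple_form d m (-1) (4 * m) by rewrite /d; split; lia.
have F2 : F m (-1) = F 2 1.
  by rewrite -F1 -(F_shift (-1) sf2); congr (F m _); ring.
have sf3 : simple_form d m (2 * m - 1) (3 * m + 1) by rewrite /d; split; lia.
have F3 : F m (2 * m - 1) = F 2 1.
  by rewrite -F2 -(F_shift (-1) sf3); congr (F m _); ring.
move=> sf; case=> [[a1 [k ek]]|[c1 [k ek]]|[] [a1 b1 c1]|[] [a1 b1 c1]].
- by rewrite a1 in sf *; exact: two sf ek.
- by rewrite c1 in sf; exact: c_two sf ek.
- by rewrite -F3 -(F_swap sf) c1 b1; congr (F m _); ring.
- by rewrite -F2 -(F_swap sf) c1 b1.
- by rewrite -F1 -(F_swap sf) c1 b1; congr (F m _); ring.
- by rewrite a1 b1.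
- by rewrite a1 b1.
- by rewrite a1 b1.
Qed.
End ListInvariants.

(** * Ideal classes of simple forms *)

Section ClassNumber.
Variables (K : fieldType) (phi : {rmorphism K -> algC}) (w : K) (m : nat).
Let e := 4 * m%:Z ^+ 2.
Hypothesis m_gt0 : (0 < m)%N.
Hypothesis w_sqr : w ^+ 2 = w + e%:~R.
Hypothesis w_gen : forall x : K, exists p q r : int,
  r != 0 /\ r%:~R * x = p%:~R + q%:~R * w.
Hypothesis sqfree : forall k : int, (k ^+ 2 %| 16 * m%:Z ^+ 2 + 1)%Z -> `|k| = 1.

Let d := 16 * m%:Z ^+ 2 + 1.
Let dE : 4 * e + 1 = d. Proof. by rewrite /e /d; ring. Qed.

Lemma nonsquare (k : int) : k ^+ 2 != d.
Proof.
apply/eqP; rewrite /d => ek.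
have [?|[?|?]] : k <= - 4 * m%:Z - 1 \/ `|k| <= 4 * m%:Z \/ 4 * m%:Z + 1 <= k by lia.
- by nia.
- by nia.
- by nia.
Qed.

Let nonsq (k : int) : k ^+ 2 != 4 * e + 1. Proof. by rewrite dE nonsquare. Qed.
Let sqf (k : int) : (k ^+ 2 %| 4 * e + 1)%Z -> `|k| = 1.
Proof. by rewrite dE; exact: sqfree. Qed.
Let e_gt0 : 0 < e. Proof. by rewrite /e; nia. Qed.

(** Simple forms have odd [b], for which the quotient is the exact [j] of [b = 2 j + 1]. *)
Definition form_class (a b : int) : set (set K) := ideal_class (lat w a ((b - 1) %/ 2)%Z).

Lemma form_classE (a j : int) : form_class a (2 * j + 1) = ideal_class (lat w a j).
Proof. by rewrite /form_class addrK mulKz. Qed.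

Lemma simple_formE (a j c : int) :
  simple_form d a (2 * j + 1) c -> a != 0 /\ a * c = e - j ^+ 2 - j.
Proof. by case=> a0 c0; rewrite /d /e => disc; split; lia. Qed.

Lemma simple_fractional (a j c : int) : simple_form d a (2 * j + 1) c ->
  fractional_ideal (lat w a j).
Proof. by case/simple_formE => a0 ac; apply: (lat_fractional phi w_sqr w_gen nonsq sqf a0 ac). Qed.

Lemma form_class_shift a b c k : simple_form d a b c ->
  form_class a (b + 2 * k * a) = form_class a b.
Proof.
move=> sf; have [[j ej] _] := form_odd (m_gt0 : 0 < m%:Z) sf; rewrite ej.
rewrite (_ : 2 * j + 1 + 2 * k * a = 2 * (j + k * a) + 1); last by ring.
by rewrite !form_classE lat_shift.
Qed.

Lemma form_class_swap a b c : simple_form d a b c -> form_class c (- b) = form_class a b.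
Proof.
move=> sf; have [[j ej] _] := form_odd (m_gt0 : 0 < m%:Z) sf; rewrite ej in sf *.
have [a0 ac] := simple_formE sf.
rewrite (_ : - (2 * j + 1) = 2 * (- j - 1) + 1); last by ring.
rewrite !form_classE; apply/ideal_class_eq; first exact: simple_fractional sf.
exact/ideal_equiv_sym/(lat_swap phi w_sqr nonsq a0 ac).
Qed.

Lemma form_class_closed L a b c a' b' c' : step_closed d L ->
  step_closed d (fun a b c => L a (- b) c) ->
  simple_form d a b c -> simple_form d a' b' c' ->
  form_class a b = form_class a' b' -> L a' b' c' -> L a b c.
Proof.
move=> Lc Lc' sf sf'; have [[j ej] _] := form_odd (m_gt0 : 0 < m%:Z) sf.
have [[j' ej'] _] := form_odd (m_gt0 : 0 < m%:Z) sf'.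
rewrite ej ej' in sf sf' *; rewrite !form_classE.
have [a0 ac] := simple_formE sf; have [a0' ac'] := simple_formE sf'.
move/(ideal_class_eq _ (simple_fractional sf')) => eqv.
have [x [y [z [u [det E1 E2]]]]] := lat_equiv_matrix phi w_sqr nonsq ac ac' a0' eqv.
apply: (@step_closed_equiv (4 * m%:Z) d L _ nonsquare Lc Lc' _ _ _ _ _ _ x y z u sf sf' det).
- by rewrite /d; ring.
- by rewrite -mulrA E1; ring.
- by rewrite -mulrA E2; ring.
Qed.

Lemma mem_ideal_classes a b c : simple_form d a b c -> @ideal_classes K (form_class a b).
Proof.
move=> sf; have [[j ej] _] := form_odd (m_gt0 : 0 < m%:Z) sf; rewrite ej in sf *.
by exists (lat w a j); [exact: simple_fractional sf | rewrite form_classE].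
Qed.

Lemma ideal_classesP C : @ideal_classes K C ->
  exists a b c, simple_form d a b c /\ C = form_class a b.
Proof.
move=> [J fJ <-].
have [a [j [c [sf eqv]]]] := fractional_simple phi w_sqr w_gen nonsq sqf e_gt0 fJ.
rewrite dE in sf; exists a, (2 * j + 1), c; split=> //.
by rewrite form_classE; apply/ideal_class_eq; [exact: simple_fractional sf | exact: ideal_equiv_sym].
Qed.

Lemma known_list_class a b c : simple_form d a b c -> known_list m a b c ->
  [\/ form_class a b = form_class 1 1, form_class a b = form_class 2 1
    | form_class a b = form_class 2 (-1)].
Proof.
have m0 : 0 < m%:Z by [].
move=> sf [] kn; [constructor 1|constructor 2|constructor 3].
- exact: (unit_list_invariant m0 form_class_shift form_class_swap sf kn).
- exact: (two_list_invariant m0 form_class_shift form_class_swap sf kn).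
have sfN a' b' c' : simple_form d a' b' c' -> simple_form d a' (- b') c'.
  by case=> ? ? <-; split=> //; ring.
rewrite -[b]opprK.
(* The class of the conjugate form is again invariant, so the lemma for [two_list] also covers its
   conjugate. *)
apply: (@two_list_invariant _ (fun a b => form_class a (- b)) m m0 _ _ _ _ _ (sfN _ _ _ sf) kn).
- move=> a' b' c' k /sfN sf'; rewrite -(form_class_shift (- k) sf').
  by congr form_class; ring.
- by move=> a' b' c' /sfN; exact: form_class_swap.
Qed.

Let sf_one : simple_form d 1 1 (4 * m%:Z ^+ 2). Proof. by rewrite /d; split; nia. Qed.
Let sf_two : simple_form d 2 1 (2 * m%:Z ^+ 2). Proof. by rewrite /d; split; nia. Qed.
Let sf_two' : simple_form d 2 (-1) (2 * m%:Z ^+ 2). Proof. by rewrite /d; split; nia. Qed.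

Lemma unit_class_known a b c : simple_form d a b c ->
  form_class a b = form_class 1 1 -> unit_list m a b c.
Proof.
move=> sf eqv; have Lc := @unit_list_closed m m_gt0.
by apply: (form_class_closed Lc Lc sf sf_one eqv); constructor 1.
Qed.

Lemma two_class_known a b c : simple_form d a b c ->
  form_class a b = form_class 2 1 -> two_list m a b c.
Proof.
move=> sf eqv.
apply: (form_class_closed (@two_list_closed m m_gt0) (@two_list_conj_closed m m_gt0) sf sf_two eqv).
by constructor 1; split=> //; exists 0.
Qed.

Lemma two_conj_class_known a b c : simple_form d a b c ->
  form_class a b = form_class 2 (-1) -> two_list m a (- b) c.
Proof.
move=> sf eqv.
apply: (form_class_closed (L := fun a b c => two_list m a (- b) c)
  (@two_list_conj_closed m m_gt0) _ sf sf_two' eqv).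
  move=> a' b' c' sf'; rewrite opprK => /(@two_list_closed m m_gt0 _ _ _ sf')[H1 H2].
  by rewrite !opprK.
by constructor 1; split=> //; exists 0.
Qed.

Lemma classes_distinct : (2 < m)%N -> [/\ form_class 2 1 <> form_class 1 1,
  form_class 2 (-1) <> form_class 1 1 & form_class 2 (-1) <> form_class 2 1].
Proof.
move=> m2; split.
- by move/(unit_class_known sf_two) => [|?|[]]; [lia|nia|lia].
- by move/(unit_class_known sf_two') => [|?|[]]; [lia|nia|lia].
move/(two_class_known sf_two'); case=> [[_ [k ek]]|[c1 _]|[] [a1 b1 c1]|[] [a1 b1 c1]].
all: lia.
Qed.

Lemma class_number3P : (2 < m)%N -> class_number K = 3%N <->
  (forall a b c : int, simple_form d a b c -> known_list m a b c).
Proof.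
move=> m2; have [n1 n2 n3] := classes_distinct m2.
pose S := [set form_class 1 1; form_class 2 1; form_class 2 (-1)].
have SC : S `<=` @ideal_classes K.
  move=> C [[->|->]|->]; [exact: mem_ideal_classes sf_one | exact: mem_ideal_classes sf_two
    | exact: mem_ideal_classes sf_two'].
have h3 : class_number K = 3%N <-> @ideal_classes K = S.
  by apply: card_fset_set3 => //; apply: SC; [left; left|left; right|right].
rewrite h3; split=> [CS a b c sf|kn].
  have := mem_ideal_classes sf; rewrite CS => -[[E|E]|E].
  - by constructor 1; exact: unit_class_known E.
  - by constructor 2; exact: two_class_known E.
  - by constructor 3; exact: two_conj_class_known E.
apply/seteqP; split=> // C /ideal_classesP[a [b [c [sf ->]]]].
by have [->|->|->] := known_list_class sf (kn _ _ _ sf); [left; left|left; right|right].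
Qed.

Lemma class_number_small : (m <= 2)%N -> class_number K <> 3%N.
Proof.
move=> m2; have m12 : (m == 1)%N || (m == 2)%N by lia.
have two_eq : form_class 2 (-1) = form_class 2 1.
  apply: (two_list_invariant (m_gt0 : 0 < m%:Z) form_class_shift form_class_swap sf_two').
  (* The form [(2, -1, 2 m^2)] is [(2, -1, 2)] for [m = 1], with [c = 2]; for [m = 2] it is
     [(m, -1, 4 m)]. The two conjugate cycles thus meet. *)
  case/orP: m12 => /eqP ->; first by constructor 2; split=> //; exists (-1).
  by constructor 4; constructor 2.
have sub : @ideal_classes K `<=` [set` [fset form_class 1 1; form_class 2 1]%fset].
  move=> C /ideal_classesP[a [b [c [sf ->]]]] /=; rewrite !inE.
  have := known_list_class sf (simple_form_small m12 sf).
  by rewrite two_eq => -[] ->; rewrite eqxx ?orbT.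
have fin := sub_finite_set sub (finite_fset _).
move: sub; rewrite (fset_set_sub fin (finite_fset _)) set_fsetK.
move/fsubset_leq_card; rewrite cardfs2 /class_number.
by case: (_ != _) => /= le c3; move: le; rewrite c3.
Qed.
End ClassNumber.

(** * The generator [sqrt d] and the complex embedding of the field *)

Section FieldGenerators.
Variable d : nat.
Let K := quadratic_field d.

Lemma quadratic_root :
  root (map_poly (ratr : {rmorphism rat -> algC}) ('X^2 - d%:R%:P)) (sqrtC d%:R).
Proof.
rewrite rmorphB /= map_polyXn map_polyC /= /root !hornerE sqrtCK ratr_nat.
by rewrite subrr.
Qed.

Lemma quadratic_poly_neq0 : ('X^2 - d%:R%:P : {poly rat}) != 0.
Proof. by rewrite -size_poly_eq0 size_XnsubC. Qed.

Definition quadratic_embedding : {rmorphism K -> algC} := 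
  subfx_inj (F := rat) (L := algC) (iota := ratr) (z := sqrtC d%:R) (p := 'X^2 - d%:R%:P).

Definition quadratic_sqrt : K := subfx_root _ _ _.

Lemma quadratic_embedding_sqrt : quadratic_embedding quadratic_sqrt = sqrtC d%:R.
Proof. exact: subfx_inj_root quadratic_root quadratic_poly_neq0. Qed.

Lemma quadratic_sqrtK : quadratic_sqrt ^+ 2 = d%:R.
Proof.
apply: (fmorph_inj quadratic_embedding).
by rewrite rmorphXn /= quadratic_embedding_sqrt sqrtCK rmorph_nat.
Qed.

Lemma horner_sqrtC (q : {poly rat}) : exists a b r : int, r != 0 /\
  r%:~R * (map_poly (ratr : rat -> algC) q).[sqrtC d%:R] = a%:~R + b%:~R * sqrtC d%:R.
Proof.
elim/poly_ind: q => [|q c [a [b [r [r0 E]]]]].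
  by exists 0, 0, 1; rewrite rmorph0 horner0; split=> //; ring.
exists (denq c * b * d%:Z + numq c * r), (denq c * a), (denq c * r).
rewrite mulf_neq0 ?denq_neq0 //; split=> //.
have -> : (map_poly (ratr : rat -> algC) (q * 'X + c%:P)).[sqrtC d%:R] =
    (map_poly (ratr : rat -> algC) q).[sqrtC d%:R] * sqrtC d%:R + ratr c.
  by rewrite rmorphD rmorphM /= map_polyX map_polyC hornerMXaddC.
have dc : (denq c)%:~R * ratr c = (numq c)%:~R :> algC.
  by rewrite /ratr mulrCA divff ?mulr1 // intr_eq0 denq_neq0.
transitivity ((denq c)%:~R * (r%:~R * (map_poly (ratr : rat -> algC) q).[sqrtC d%:R]) * sqrtC d%:R
   + r%:~R * ((denq c)%:~R * ratr c)); first by ring.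
rewrite E dc; apply/eqP; rewrite -subr_eq0; apply/eqP.
transitivity ((denq c)%:~R * b%:~R * (sqrtC d%:R ^+ 2 - d%:R : algC)); first by ring.
by rewrite sqrtCK subrr mulr0.
Qed.

Lemma quadratic_gen (x : K) : exists a b r : int,
  r != 0 /\ r%:~R * x = a%:~R + b%:~R * quadratic_sqrt.
Proof.
have [q ->] := subfxE x; have [a [b [r [r0 E]]]] := horner_sqrtC q.
exists a, b, r; split=> //; apply: (fmorph_inj quadratic_embedding).
rewrite rmorphD !rmorphM /= !rmorph_int quadratic_embedding_sqrt -E; congr (_ * _).
exact: subfx_inj_eval quadratic_root quadratic_poly_neq0 _.
Qed.
End FieldGenerators.

Lemma class_number_quadratic (m : nat) : (0 < m)%N -> squarefree (16 * m ^ 2 + 1) ->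
  ((2 < m)%N -> h (16 * m ^ 2 + 1) = 3%N <->
     forall a b c : int, simple_form (16 * m%:Z ^+ 2 + 1) a b c -> known_list m a b c)
  /\ ((m <= 2)%N -> h (16 * m ^ 2 + 1) <> 3%N).
Proof.
move=> m0 sqf; set d := (16 * m ^ 2 + 1)%N in sqf *.
have phi := quadratic_embedding d.
have inj (a : int) : a != 0 -> a%:~R != 0 :> quadratic_field d := @intr_neq0_quad _ phi a.
have n2 : 2 != 0 :> quadratic_field d by apply: (inj 2).
pose s : quadratic_field d := quadratic_sqrt d; pose w := (1 + s) / 2.
have sE : s = 2 * w - 1 by rewrite /w mulrC divfK //; ring.
have w_sqr : w ^+ 2 = w + (4 * m%:Z ^+ 2)%:~R.
  have s2 : s ^+ 2 = (16 * m%:Z ^+ 2 + 1)%:~R by rewrite quadratic_sqrtK /d; ring.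
  apply: (mulfI n2); apply: (mulfI n2); apply/eqP; rewrite -subr_eq0; apply/eqP.
  transitivity (s ^+ 2 - (16 * m%:Z ^+ 2 + 1)%:~R); first by rewrite sE; ring.
  by rewrite s2 subrr.
have w_gen (x : quadratic_field d) : exists p q r : int,
    r != 0 /\ r%:~R * x = p%:~R + q%:~R * w.
  have [a [b [r [r0 E]]]] := quadratic_gen x; exists (a - b), (2 * b), r; split=> //.
  by rewrite E -/s sE; ring.
have sqf' (k : int) : (k ^+ 2 %| 16 * m%:Z ^+ 2 + 1)%Z -> `|k| = 1.
  rewrite (_ : 16 * m%:Z ^+ 2 + 1 = d%:Z); last by rewrite /d; lia.
  by rewrite dvdzE abszX => /sqf k1; lia.
split=> m2; first exact: (class_number3P phi m0 w_sqr w_gen sqf' m2).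
exact: (class_number_small phi m0 w_sqr w_gen sqf' m2).
Qed.

Theorem theorem3p3 (n d : nat) (n_gt0 : (0 < n)%N) (d_def : d = (n ^ 2 + 1)%N)
    (d_sqfree : squarefree d) (d_mod8 : d = 1 %[mod 8]) :
  (h d = 3%N ->
     (sigma_sum d)%:R = (n%:R ^+ 3 + 44%:R * n%:R) / 4%:R :> rat)
  /\ (odd (h d) -> d <> 17%N ->
     (sigma_sum d)%:R = (n%:R ^+ 3 + 44%:R * n%:R) / 4%:R :> rat ->
     h d = 3%N).
Proof.
have [m nm] : exists m, n = (4 * m)%N.
  (* Modulo 8, [n^2 + 1] depends only on the residue of [n] modulo 4, and is 1 only for residue
     0. *)
  exists (n %/ 4)%N; move: d_mod8; rewrite d_def.
  rewrite {1 2}(divn_eq n 4); have := ltn_pmod n (isT : 0 < 4)%N.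
  move: (n %/ 4)%N (n %% 4)%N => q r r4.
  rewrite (_ : ((q * 4 + r) ^ 2 + 1 = (2 * q ^ 2 + q * r) * 8 + (r ^ 2 + 1))%N); last by lia.
  rewrite modnMDl; case: r r4 => [|[|[|[|//]]]] // _ _; lia.
have m0 : (0 < m)%N by lia.
have dm : d = (16 * m ^ 2 + 1)%N by rewrite d_def nm; lia.
have rhs x : x%:R = (n%:R ^+ 3 + 44%:R * n%:R) / 4%:R :> rat <-> x = (16 * m ^ 3 + 44 * m)%N.
  have -> : (n%:R ^+ 3 + 44%:R * n%:R) / 4%:R = (16 * m ^ 3 + 44 * m)%N%:R :> rat.
    by rewrite nm; field.
  by split=> [/eqP|->//]; rewrite eqr_nat => /eqP.
rewrite !rhs {rhs}; rewrite dm in d_sqfree *.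
have [big small] := class_number_quadratic m0 d_sqfree.
have [m2|m3] := leqP m 2.
  split=> [/(small m2)//|_ d17]; have [m1|->] : m = 1%N \/ m = 2%N by lia.
    by case: d17; rewrite m1.
  by rewrite sigma_sum_65.
have [big1 big2] := big m3; have [s1 s2] := sigma_sum_known m3.
by split=> [/big1/s2|_ _ /s1/big2].
Qed.
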